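(* Let $m\ge 2$ and let $G$ be a connected simple graph with $v$ vertices and $b$ blocks. Then the homological span of the chromatic homology of $G$ over $\mathcal{A}_m$ is \[\mathrm{hspan}\big(H^{*,*}_{\mathcal{A}_m}(G)\big)=v-b.\]
   Context: $\mathcal{A}_m=\mathbb{Z}[x]/(x^m)$. Chromatic complex over $\mathcal{A}_m$: fix a total order on $E(G)$; an enhanced state is $(H,\epsilon)$ with $H$ a spanning subgraph and $\epsilon$ assigning to each component of $H$ an element of $\{1,x,\dots,x^{m-1}\}$; $C^{i}$ is free abelian on enhanced states with $|E(H)|=i$ (quantum grading $j$ = sum of exponents of $\epsilon$); $d(H,\epsilon)=\sum_{e\notin E(H)}(-1)^{\#\{e'\in E(H):e'<e\}}(H\cup e,\epsilon_e)$, where if $e$ merges components $C_1,C_2$ the merged component gets $\epsilon(C_1)\epsilon(C_2)\in\mathcal{A}_m$ (term zero if this is $0$) and otherwise $\epsilon_e=\epsilon$. $H^{i,j}_{\mathcal{A}_m}(G)$ is its homology. A block of $G$ is a maximal $2$-connected subgraph or a bridge. If $i_{\min}$ and $i_{\max}$ are the smallest and largest $i$ with $\bigoplus_j H^{i,j}_{\mathcal{A}_m}(G)\neq 0$, then $\mathrm{hspan}=i_{\max}-i_{\min}+1$. *)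

(* Defs.v *)
From HB Require Import structures.
From mathcomp Require Import all_boot all_order all_algebra.
From mathcomp Require Import boolp.

Set Implicit Arguments.
Unset Strict Implicit.
Unset Printing Implicit Defensive.

Import GRing.Theory.
Local Open Scope ring_scope.

Section Graphs.

Variable T : finType.

(* A finite simple graph with vertex set T is given by its edge set, a set of
   2-element subsets of T. *)
Definition simple_graph (E : {set {set T}}) : Prop :=
  forall f, f \in E -> #|f| = 2.

Definition adj (F : {set {set T}}) : rel T := [rel x y | [set x; y] \in F].

(* Vertex sets of the components of the spanning subgraph (T, F), isolated
   vertices included. *)
Definition components (F : {set {set T}}) : {set {set T}} :=
  equivalence_partition (connect (adj F)) [set: T].

(* A graph on a subset of T: its vertex set and its edge set. *)
Definition graph : Type := ({set T} * {set {set T}})%type.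

Definition subgraph (K L : graph) : bool :=
  (K.1 \subset L.1) && (K.2 \subset L.2).

Definition well_formed (K : graph) : bool :=
  [forall f in K.2, f \subset K.1].

Definition connected_graph (K : graph) : bool :=
  (K.1 != set0) && [forall x in K.1, forall y in K.1, connect (adj K.2) x y].

Definition delete_vertex (K : graph) (w : T) : graph :=
  (K.1 :\ w, [set f in K.2 | w \notin f]).

Definition two_connected (K : graph) : bool :=
  [&& (3 <= #|K.1|)%N, connected_graph K
    & [forall w in K.1, connected_graph (delete_vertex K w)]].

Definition two_connected_subgraph (E : {set {set T}}) (K : graph) : bool :=
  [&& well_formed K, subgraph K ([set: T], E) & two_connected K].

Definition maximal_two_connected (E : {set {set T}}) (K : graph) : bool :=
  two_connected_subgraph E K &&
  [forall L : graph,
    two_connected_subgraph E L && subgraph K L ==> (L == K)].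

Definition bridge (E : {set {set T}}) (f : {set T}) : bool :=
  (f \in E) && (#|components E| < #|components (E :\ f)|)%N.

Definition blocks (E : {set {set T}}) : {set graph} :=
  [set K : graph | maximal_two_connected E K]
    :|: [set (f, [set f]) | f in [set f | bridge E f]].

End Graphs.

Section ChromaticHomology.

Variables (T : finType) (m : nat) (E : {set {set T}}) (le : rel {set T}).

Definition total_order_on : Prop :=
  [/\ {in E, reflexive le}, {in E &, antisymmetric le},
      {in E & &, transitive le} & {in E &, total le}].

Definition spanning : Type := {H : {set {set T}} | H \subset E}.
HB.instance Definition _ := Finite.on spanning.

Definition component (H : spanning) : Type :=
  {C : {set T} | C \in components (val H)}.
HB.instance Definition _ H := Finite.on (component H).

(* The label x^k of a component is recorded by its exponent k : 'I_m. *)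
Definition state : Type := {H : spanning & {ffun component H -> 'I_m}}.
HB.instance Definition _ := Finite.on state.

Definition sedges (s : state) : {set {set T}} := val (tag s).

Definition label (s : state) : {ffun component (tag s) -> 'I_m} := tagged s.

Definition hdeg (s : state) : nat := #|sedges s|.

Definition qdeg (s : state) : nat := (\sum_(C : component (tag s)) label s C)%N.

(* The free abelian group on the (finitely many) enhanced states. *)
Definition chain : Type := {ffun state -> int}.
HB.instance Definition _ := GRing.Zmodule.on chain.

(* s' = (e |: H, eps_e) for s = (H, eps). A component of e |: H contains
   either the two components of H merged by e or exactly one component of H,
   so in both cases its label is the product of the labels of the components
   of H it contains. Exponents in s' being < m, no s' satisfies this when
   the product vanishes in Z[x]/(x^m). *)
Definition adds_edge (e : {set T}) (s s' : state) : bool :=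
  (sedges s' == e |: sedges s) &&
  [forall C : component (tag s'),
    label s' C ==
      (\sum_(D : component (tag s) | val D \subset val C) label s D)%N :> nat].

Definition edge_term (e : {set T}) (s : state) : chain :=
  [ffun s' => (adds_edge e s s')%:R].

Definition edges_before (e : {set T}) (s : state) : {set {set T}} :=
  [set e' in sedges s | (e' != e) && le e' e].

Definition d_state (s : state) : chain :=
  \sum_(e in E :\: sedges s) edge_term e s *~ (-1) ^+ #|edges_before e s|.

Definition d (c : chain) : chain := \sum_s d_state s *~ c s.

Fact d_is_zmod_morphism : {morph d : b c / b - c}.
Proof.
move=> b c; rewrite /d -sumrB; apply: eq_bigr => s _.
by rewrite !ffunE mulrzBr.
Qed.

HB.instance Definition _ := GRing.isZmodMorphism.Build chain chain d
  d_is_zmod_morphism.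

Section Bidegree.

Variables i j : nat.

Definition cycles : {pred chain} := [pred c : chain |
  [forall s, (c s != 0) ==> (hdeg s == i) && (qdeg s == j)] && (d c == 0)].

Fact cycles_zmod_closed : zmod_closed cycles.
Proof.
split=> [|b c].
  by rewrite inE raddf0 eqxx andbT; apply/forallP => s; rewrite ffunE eqxx.
rewrite !inE => /andP[/forallP bij /eqP db0] /andP[/forallP cij /eqP dc0].
rewrite d_is_zmod_morphism db0 dc0 subr0 eqxx andbT; apply/forallP => s; apply/implyP.
move: (bij s) (cij s); rewrite !ffunE.
by case: (b s =P 0) => [->|_ /= -> //]; case: (c s =P 0) => [->|_ /= _ -> //].
Qed.

HB.instance Definition _ := GRing.isZmodClosed.Build chain cycles
  cycles_zmod_closed.

Record cycle : Type := Cycle { cycle_chain :> chain; _ : cycle_chain \in cycles }.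

HB.instance Definition _ := [isSub for cycle_chain].
HB.instance Definition _ := [Choice of cycle by <:].
HB.instance Definition _ := [SubChoice_isSubZmodule of cycle by <:].

(* The preimage lies in bidegree (i - 1, j); for i = 0 this forces b = 0. *)
Definition boundaries : {pred cycle} := [pred z : cycle |
  `[< exists b : chain,
        (forall s, b s != 0 -> (hdeg s).+1 = i /\ qdeg s = j) /\ d b = z >]].

Fact boundaries_zmod_closed : zmod_closed boundaries.
Proof.
split=> [|y z]; rewrite !inE.
  apply/asboolP; exists 0; rewrite raddf0; split=> // s.
  by rewrite ffunE eqxx.
move=> /asboolP[b [bij db]] /asboolP[c [cij dc]]; apply/asboolP.
exists (b - c); rewrite d_is_zmod_morphism db dc; split=> // s.
rewrite !ffunE; case: (eqVneq (b s) 0) => [->|bs0 _]; last exact: bij.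
by case: (eqVneq (c s) 0) => [->|cs0 _]; [rewrite subr0 eqxx | exact: cij].
Qed.

HB.instance Definition _ := GRing.isZmodClosed.Build cycle boundaries
  boundaries_zmod_closed.

Definition homology : Type := Quotient.quot boundaries.
HB.instance Definition _ := GRing.Zmodule.on homology.

End Bidegree.

(* The direct sum over j of the groups H^{i,j} is nonzero. *)
Definition nonzero_degree (i : nat) : Prop :=
  exists j, exists h : homology i j, h <> 0.

(* imin <= imax, so that the truncated subtraction is exact. *)
Definition is_hspan (n : nat) : Prop :=
  exists imin imax : nat,
    [/\ nonzero_degree imin, forall i, nonzero_degree i -> (imin <= i)%N,
        nonzero_degree imax, forall i, nonzero_degree i -> (i <= imax)%N
      & n = (imax - imin + 1)%N].

End ChromaticHomology.

(* Main.v *)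
Require Import Defs.
From mathcomp Require Import all_boot all_order all_algebra.
From mathcomp Require Import boolp zify.

Set Implicit Arguments.
Unset Strict Implicit.
Unset Printing Implicit Defensive.

Import GRing.Theory.
Local Open Scope ring_scope.

(* For edge sets P, Q the enhanced states whose edge set lies between P and
   P :|: Q form a subquotient of the chromatic complex, namely the complex of the
   minor that contracts P and keeps Q; for e in Q there is a long exact sequence
   relating it to the minors that delete and contract e.  If the cycle matroid of
   a minor has rank r and splits into b direct summands, induction along these
   sequences shows that its cohomology vanishes in (shifted) degree > r - b, and
   in every degree for quantum degree < b: a loop makes the complex acyclic, and
   for a forest all cohomology sits in the lowest degree.  If moreover the b
   summands are connected, the group in degree r - b and quantum degree b is
   nonzero: by Tutte's lemma deleting or contracting e keeps its summand
   connected, and if deletion does not then it increases the number of summands,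
   so the deletion contributes nothing in quantum degree b.  For a connected
   graph r = v - 1 and the summands of the cycle matroid are the blocks, so the
   largest nonzero degree is v - 1 - b; the smallest one is 0, since the state
   without edges all of whose labels are x^(m-1) is a cycle. *)

(** * Based cochain complexes *)

(** Contraction creates loops and parallel edges and deletion may disconnect, so the induction runs
    over pairs [P], [Q] and speaks of matroid rank rather than of vertices. Homological degrees
    count the edges of [P] too. With this normalization, contracting a nonloop moves one unit from
    the rank to [#|P|], deleting a noncoloop changes neither, and both keep the splitting into b
    classes, so one bound [#|P| + r - b] serves a minor and its two descendants. The vanishing does
    not ask for connected summands; this is what allows it to be applied to the finer splitting of a
    deletion that became disconnected. Nonvanishing is carried over the integers in contrapositive
    form: exactness of a minor would force exactness of one with fewer edges, so no ranks or torsion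
    are computed. The quantum degree b originates in forests: a leaf labelled 1 cancels against the
    contraction of its edge, so each edge costs a factor x and a forest starts in quantum degree
    equal to its number of edges. The bidegree used is the corner of the two vanishing regions,
    where a neighbouring term of the long exact sequence is zero. *)

Section BasedComplex.

Variables (S : finType) (deg : S -> nat) (D : S -> S -> int).
Hypothesis deg_D : forall s t, D s t != 0 -> deg t = (deg s).+1.

Implicit Types (A B U V : {set S}) (b c : S -> int).

(** The matrix [D] is global and [U] selects a block of it, so subcomplexes and quotients are mere
    sets of basis elements and chains on different blocks have the same type. *)
Definition diff U c t : int := \sum_(s in U) c s * D s t.

(* Vanishing of the cohomology in degree i of the complex spanned by U, whose
   differential is the U-block of D; values of chains off U are ignored. *)
Definition exact_at U i : Prop := forall c,
  (forall s, s \in U -> deg s != i -> c s = 0) ->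
  (forall t, t \in U -> diff U c t = 0) ->
  exists b, (forall s, s \in U -> b s != 0 -> (deg s).+1 = i) /\
            (forall t, t \in U -> diff U b t = c t).

Definition is_complex U := forall s u, s \in U -> u \in U ->
  \sum_(t in U) D s t * D t u = 0.

Definition no_arrow A B := forall s t, s \in A -> t \in B -> D s t = 0.

Lemma diffD U b c t : diff U (fun s => b s + c s) t = diff U b t + diff U c t.
Proof. by rewrite -big_split; apply: eq_bigr => s _; rewrite mulrDl. Qed.

Lemma diffB U b c t : diff U (fun s => b s - c s) t = diff U b t - diff U c t.
Proof. by rewrite -sumrB; apply: eq_bigr => s _; rewrite mulrBl. Qed.

Lemma diff_diff U c t : is_complex U -> t \in U -> diff U (diff U c) t = 0.
Proof.
move=> cU tU; rewrite /diff.
under eq_bigr => s _ do rewrite mulr_suml.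
rewrite exchange_big /= big1 // => s sU.
under eq_bigr => u _ do rewrite -mulrA.
by rewrite -mulr_sumr cU // mulr0.
Qed.

Lemma diff_neq0 U c t :
  diff U c t != 0 -> exists s, [/\ s \in U, c s != 0 & deg t = (deg s).+1].
Proof.
move=> h; have [/exists_inP[s sU h1]|/exists_inPn h1] :=
  boolP [exists s in U, c s * D s t != 0].
  move: h1; rewrite mulf_eq0 negb_or => /andP[c0 d0].
  by exists s; split => //; exact: deg_D.
by move/eqP: h; case; apply: big1 => s sU; apply/eqP; rewrite -[_ == _]negbK h1.
Qed.

Definition restr A c s : int := if s \in A then c s else 0.

Lemma diff_restr A U c t : A \subset U -> diff U (restr A c) t = diff A c t.
Proof.
move=> /subsetP sAU; rewrite /diff (bigID (mem A)) /= [X in _ + X]big1 ?addr0.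
  apply: eq_big => [s|s /andP[_ sA]]; last by rewrite /restr sA.
  by apply/andP/idP => [[]|sA] //; rewrite sAU.
by move=> s /andP[_ /negbTE sA]; rewrite /restr sA mul0r.
Qed.

Lemma exact_at_set0 i : exact_at set0 i.
Proof.
by move=> c _ _; exists (fun=> 0); split=> s; rewrite inE.
Qed.

Section Split.

Variables A B : {set S}.
Let U := A :|: B.
Hypothesis disAB : [disjoint A & B].

Let sAU : A \subset U. Proof. exact: subsetUl. Qed.
Let sBU : B \subset U. Proof. exact: subsetUr. Qed.

Let inA s : s \in A -> (s \in A) * ((s \in B) = false) * (s \in U).
Proof. by move=> sA; rewrite (disjointFr disAB sA) inE sA. Qed.
Let inB s : s \in B -> (s \in B) * ((s \in A) = false) * (s \in U).
Proof. by move=> sB; rewrite (disjointFl disAB sB) inE sB orbT. Qed.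

Let AU s : s \in A -> s \in U. Proof. by case/inA. Qed.
Let BU s : s \in B -> s \in U. Proof. by case/inB. Qed.

Lemma diffU c t : diff U c t = diff A c t + diff B c t.
Proof. by rewrite /diff -bigU //; apply: eq_bigl => s; rewrite !inE. Qed.

Lemma diff_no_arrow V C c t : no_arrow V C -> t \in C -> diff V c t = 0.
Proof. by move=> h tC; apply: big1 => s sV; rewrite h // mulr0. Qed.

Lemma exact_at_summand i :
  no_arrow A B -> no_arrow B A -> exact_at (A :|: B) i -> exact_at A i.
Proof.
move=> nAB nBA eU c degc dc.
have [|t|b [degb db]] := eU (restr A c).
- by move=> s _ h; rewrite /restr; case: ifP => // sA; exact: degc.
- rewrite diff_restr // inE => /orP[/dc //|tB]; exact: diff_no_arrow tB.
exists b; split=> [s sA|t tA]; first by apply: degb; exact: AU.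
have := db t (AU tA).
by rewrite diffU (diff_no_arrow _ nBA) // addr0 /restr tA.
Qed.

Hypothesis nBA : no_arrow B A.
Hypothesis cU : is_complex U.

(** Without arrows from [B] to [A], [B] is a subcomplex and [A] the quotient. This lemma and the
    next two are the uses made of the sequence H^{i-1}(A) -> H^i(B) -> H^i(U) -> H^i(A) ->
    H^{i+1}(B). *)
Lemma exact_at_ext i : exact_at A i -> exact_at B i -> exact_at (A :|: B) i.
Proof.
move=> eA eB c degc dc.
have [|t tA|b [degb db]] := eA c.
- by move=> s sA; apply: degc; exact: AU.
- by have := dc t (AU tA); rewrite diffU (diff_no_arrow _ nBA) // addr0.
(* Subtracting the boundary of the lifted primitive leaves a cycle supported on [B]. *)
pose c' s := c s - diff U (restr A b) s.
have c'A s : s \in A -> c' s = 0.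
  by move=> sA; rewrite /c' diff_restr // db // subrr.
have dc' t : t \in U -> diff U c' t = 0.
  by move=> tU; rewrite diffB dc // diff_diff // subr0.
have [|t tB|b' [degb' db']] := eB c'.
- move=> s sB ds; rewrite /c' (degc s (BU sB) ds) sub0r; apply/eqP.
  rewrite oppr_eq0; apply/negPn/negP => /diff_neq0[u [_]].
  rewrite /restr; case: ifP; rewrite ?eqxx // => uA /(degb u uA) du dsu.
  by rewrite dsu du eqxx in ds.
- rewrite -[RHS](dc' t (BU tB)) diffU [X in _ = X + _]big1 ?add0r // => s sA.
  by rewrite c'A // mul0r.
exists (fun s => restr A b s + restr B b' s); split=> [s sU|t tU].
  rewrite /restr; move: sU; rewrite inE => /orP[sA|sB].
    by rewrite !(inA sA) addr0; exact: degb.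
  by rewrite !(inB sB) add0r; exact: degb'.
rewrite diffD (diff_restr b') //; move: (tU); rewrite inE => /orP[tA|tB].
  by rewrite (diff_no_arrow _ nBA tA) diff_restr // db // addr0.
by rewrite db' // /c' addrC subrK.
Qed.

(** The connecting map: the boundary in [U] of an [A]-cycle lies in [B], and a primitive of it there
    corrects the cycle to one of [U]. *)
Lemma exact_at_quotient i :
  exact_at (A :|: B) i -> exact_at B i.+1 -> exact_at A i.
Proof.
move=> eU eB c degc dc.
have dcA t : t \in A -> diff U (restr A c) t = 0.
  by move=> tA; rewrite diff_restr // dc.
have [|t tB|b [degb db]] := eB (diff U (restr A c)).
- move=> s sB ds; apply/eqP/negPn/negP => /diff_neq0[u [_]].
  rewrite /restr; case: ifP; rewrite ?eqxx // => uA cu dsu.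
  rewrite dsu eqSS in ds; by rewrite degc ?eqxx in cu.
- have := diff_diff (restr A c) cU (BU tB).
  rewrite [LHS]diffU [X in X + _]big1 ?add0r // => s sA.
  by rewrite dcA // mul0r.
have [|t tU|e [dege de]] := eU (fun s => restr A c s - restr B b s).
- move=> s sU ds; rewrite /restr; move: sU; rewrite inE => /orP[sA|sB].
    by rewrite !(inA sA) subr0 degc.
  rewrite !(inB sB) sub0r; apply/eqP; rewrite oppr_eq0; apply/negPn/negP.
  by move/(degb s sB) => [] dsi; rewrite dsi eqxx in ds.
- rewrite diffB (diff_restr b) //; move: tU; rewrite inE => /orP[tA|tB].
    by rewrite dcA // (diff_no_arrow _ nBA) // subr0.
  by rewrite db // subrr.
exists e; split=> [s sA|t tA]; first by apply: dege; exact: AU.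
have := de t (AU tA); rewrite diffU (diff_no_arrow _ nBA) // addr0.
by rewrite /restr !(inA tA) subr0.
Qed.

(** If a [B]-cycle bounds in [U], the [A]-part of its primitive is a cycle one degree lower and can
    be removed. For i = 0 the value [i.-1] is again 0, harmlessly: the primitive then has no support
    at all. *)
Lemma exact_at_sub i :
  exact_at A i.-1 -> exact_at (A :|: B) i -> exact_at B i.
Proof.
move=> eA eU c degc dc.
have [|t|b [degb db]] := eU (restr B c).
- by move=> s _ h; rewrite /restr; case: ifP => // sB; exact: degc.
- rewrite diff_restr // inE => /orP[tA|/dc //]; exact: diff_no_arrow tA.
have [|t tA|f [degf df]] := eA b.
- move=> s sA ds; apply/eqP/negPn/negP => /(degb s (AU sA)) dsi.
  by rewrite -dsi eqxx in ds.
- have := db t (AU tA); rewrite diffU (diff_no_arrow _ nBA) // addr0 => ->.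
  by rewrite /restr !(inA tA).
pose e s := b s - diff U (restr A f) s.
have eA0 s : s \in A -> e s = 0.
  by move=> sA; rewrite /e diff_restr // df // subrr.
exists e; split=> [s sB|t tB].
  rewrite /e; case: (eqVneq (b s) 0) => [->|bs _].
    rewrite sub0r oppr_eq0 => /diff_neq0[u [_]].
    rewrite /restr; case: ifP; rewrite ?eqxx // => uA /(degf u uA) du ->.
    by rewrite du; case: (i) du.
  by apply: degb => //; exact: BU.
have := db t (BU tB); rewrite /restr tB => <-.
have -> : diff U b t = diff U e t by rewrite diffB diff_diff ?BU // subr0.
by rewrite diffU [X in _ = X + _]big1 ?add0r // => s sA; rewrite eA0 // mul0r.
Qed.

(* A perfect matching of unit entries from A to B makes the block of D from A
   to B invertible. *)
Lemma exact_at_matching i :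
  (forall s t, D s t != 0 -> D s t * D s t = 1) ->
  (forall t, t \in B -> exists s, [/\ s \in A, D s t != 0,
     forall s', s' \in A -> D s' t != 0 -> s' = s
   & forall t', t' \in B -> D s t' != 0 -> t' = t]) ->
  (forall s, s \in A -> exists2 t, t \in B & D s t != 0) ->
  exact_at (A :|: B) i.
Proof.
move=> unitD mB mA c degc dc.
(* The block from [A] to [B] has one nonzero entry in each row and column, of square 1, so its
   inverse is its transpose. *)
pose b s := restr A (fun s => \sum_(y in B) c y * D s y) s.
have bneq0 s : b s != 0 -> exists t, [/\ t \in B, c t != 0 & deg t = (deg s).+1].
  rewrite /b /restr; case: ifP; rewrite ?eqxx // => sA h.
  have [/exists_inP[t tB]|/exists_inPn h1] :=
    boolP [exists t in B, c t * D s t != 0].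
    rewrite mulf_eq0 negb_or => /andP[c0 d0].
    by exists t; split => //; exact: deg_D.
  by move/eqP: h; case; apply: big1 => t tB; apply/eqP; rewrite -[_ == _]negbK h1.
have degb s : s \in U -> b s != 0 -> (deg s).+1 = i.
  move=> _ /bneq0[t [tB ct <-]]; apply/eqP/negPn/negP => dt.
  by rewrite (degc t (BU tB) dt) eqxx in ct.
have dbB t : t \in B -> diff U b t = c t.
  move=> tB; have [s [sA Dst us ut]] := mB t tB.
  rewrite /b diff_restr // /diff (bigD1 s) //= [X in _ + X]big1 ?addr0.
    rewrite (bigD1 t) //= [X in _ + X]big1 ?addr0 -?mulrA ?unitD ?mulr1 //.
    move=> t' /andP[t'B t't]; apply/eqP; rewrite mulf_eq0; apply/orP; right.
    by apply/negPn/negP => /(ut _ t'B) tt; rewrite tt eqxx in t't.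
  move=> s' /andP[s'A s's]; apply/eqP; rewrite mulf_eq0; apply/orP; right.
  by apply/negPn/negP => /(us _ s'A) tt; rewrite tt eqxx in s's.
exists b; split=> // t tU; apply/eqP; rewrite eq_sym -subr_eq0; apply/eqP.
(* The remaining cycle lives on [A], where the block into [B] is injective, so it is zero. *)
pose e s := c s - diff U b s; rewrite -/(e t).
have eB s : s \in B -> e s = 0 by move=> sB; rewrite /e dbB // subrr.
have de s : s \in U -> diff U e s = 0.
  by move=> sU; rewrite diffB dc // diff_diff // subr0.
move: tU; rewrite inE => /orP[tA|/eB //].
have [y yB Dty] := mA t tA; have [s [sA _ us _]] := mB y yB.
have := de y (BU yB).
rewrite diffU [X in _ + X]big1 ?addr0; last by move=> z zB; rewrite eB // mul0r.
rewrite /diff (bigD1 t) //= [X in _ + X]big1 ?addr0.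
  by move/eqP; rewrite mulf_eq0 (negbTE Dty) orbF => /eqP.
move=> z /andP[zA zt]; apply/eqP; rewrite mulf_eq0; apply/orP; right.
apply/negPn/negP => /(us _ zA) zs; rewrite zs -(us t) ?eqxx // in zt.
Qed.

End Split.

Lemma exact_at_iso U V (f g : S -> S) i :
  {in U, forall s, f s \in V} -> {in V, forall s, g s \in U} ->
  {in U, cancel f g} -> {in V, cancel g f} ->
  {in U, forall s, deg (f s) = deg s} ->
  {in U &, forall s t, D (f s) (f t) = D s t} ->
  exact_at U i -> exact_at V i.
Proof.
move=> fV gU fK gK degf Df eU c degc dc.
have reidx h : \sum_(s in V) h s = \sum_(s in U) h (f s) :> int.
  rewrite (reindex_onto f g) //=; apply: eq_bigl => s.
  apply/andP/idP => [[fsV /eqP <-]|sU]; first exact: gU.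
  by rewrite fV // fK.
have [||b [degb db]] := eU (c \o f).
- by move=> s sU ds; apply: degc; rewrite ?fV ?degf.
- move=> t tU; rewrite -[RHS](dc (f t) (fV t tU)) /diff reidx.
  by apply: eq_bigr => s sU; rewrite Df.
exists (b \o g); split=> [s sV bs|t tV].
  by rewrite -(gK s sV) degf ?gU // degb ?gU.
rewrite /diff reidx.
rewrite -(gK t tV) -/((c \o f) (g t)) -db ?gU //.
by apply: eq_bigr => s sU; rewrite /= fK // Df // gU.
Qed.

End BasedComplex.

(** * Matroid rank functions *)

Local Open Scope nat_scope.

Section Matroid.

Variable A : finType.
Implicit Types (X Y Z W Q S : {set A}) (e f : A) (r : {set A} -> nat).

(** A local form of the axioms, easy to check on graphs: an edge that joins nothing new still joins
    nothing new in a larger edge set. Submodularity is derived from it in [rank_submod]. *)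
Record rank_axioms r : Prop := RankAxioms {
  rank0 : r set0 = 0;
  rank_leU1 : forall e X, r X <= r (e |: X);
  rank_U1_le : forall e X, r (e |: X) <= (r X).+1;
  rank_U1_sub : forall e X Y, X \subset Y -> r (e |: X) = r X -> r (e |: Y) = r Y }.

Arguments rank_U1_sub [r] _ e [X Y].

Definition contract r e X := r (e |: X) - r [set e].

Definition matroid_connected r S : bool :=
  (S != set0) && [forall X : {set A},
    [&& X \subset S, X != set0 & X != S] ==> (r X + r (S :\: X) != r S)].

Definition color_class Q (col : A -> nat) (c : nat) : {set A} :=
  [set x in Q | col x == c].

(* The b nonempty colour classes of Q are direct summands of the matroid. *)
Definition splitting r Q b (col : A -> nat) : Prop :=
  [/\ forall x, x \in Q -> col x < b,
      forall c, c < b -> color_class Q col c != set0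
    & \sum_(c < b) r (color_class Q col c) = r Q].

Section Rank.

Variables (r : {set A} -> nat) (rax : rank_axioms r).
Let r0 := rank0 rax.

(** Both increments are 0 or 1, and an increment 0 at [X] persists at [Y]. *)
Lemma rank_diminish e X Y :
  X \subset Y -> r (e |: Y) + r X <= r (e |: X) + r Y.
Proof.
move=> sXY; have := rank_U1_sub rax e sXY.
have := rank_leU1 rax e X; have := rank_U1_le rax e Y.
have := rank_U1_le rax e X; have := rank_leU1 rax e Y; lia.
Qed.

Lemma subset_ind (P : {set A} -> Prop) X Y :
  X \subset Y -> P X ->
  (forall e Z, X \subset Z -> Z \subset Y -> e \in Y -> e \notin Z ->
     P Z -> P (e |: Z)) -> P Y.
Proof.
move=> sXY PX step.
have [n] := ubnP #|Y :\: X|; elim: n X sXY PX step => // n IH X sXY PX step.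
have [/eqP|] := eqVneq (Y :\: X) set0.
  rewrite setD_eq0 => sYX _; suff -> : Y = X by [].
  by apply/eqP; rewrite eqEsubset sYX.
case/set0Pn=> e /setDP[eY eX] le_n; apply: (IH (e |: X)).
- by rewrite subUset sub1set eY.
- exact: step.
- move=> f Z sXZ sZY; apply: step => //; apply: subset_trans sXZ.
  exact: subsetUr.
- rewrite -ltnS; apply: leq_trans le_n; rewrite ltnS.
  apply: proper_card; apply/properP; split; first by apply/setDS/subsetUr.
  by exists e; rewrite !inE ?eY ?eX ?eqxx.
Qed.

Lemma rank_mono X Y : X \subset Y -> r X <= r Y.
Proof.
move=> sXY; apply: (@subset_ind (fun Y => r X <= r Y) _ _ sXY) => // e Z _ _ _ _ h.
exact: leq_trans h (rank_leU1 rax _ _).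
Qed.

Lemma rank_le_card X : r X <= #|X|.
Proof.
apply: (@subset_ind (fun X => r X <= #|X|) set0);
  rewrite ?sub0set ?cards0 ?r0 // => e Z _ _ _ eZ h.
by rewrite cardsU1 eZ; apply: leq_trans (rank_U1_le rax _ _) _; rewrite add1n.
Qed.

Lemma rank_diminishU X Y Z : X \subset Y -> r (Z :|: Y) + r X <= r (Z :|: X) + r Y.
Proof.
move=> sXY; apply: (@subset_ind
  (fun Z => r (Z :|: Y) + r X <= r (Z :|: X) + r Y) set0);
  rewrite ?sub0set ?set0U //; first by rewrite addnC.
move=> e W _ _ _ _ IH.
have /(rank_diminish e) : W :|: X \subset W :|: Y by exact: setUS.
by rewrite -!setUA; lia.
Qed.

Lemma rank_submod X Y : r (X :|: Y) + r (X :&: Y) <= r X + r Y.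
Proof.
have := rank_diminishU X (subsetIr X Y).
by rewrite setUIr setUid (setIidPl (subsetUl _ _)).
Qed.

Lemma rank_loop_sub e X : r [set e] = 0 -> r (e |: X) = r X.
Proof.
move=> e0; apply: (rank_U1_sub rax) (sub0set X) _.
by rewrite setU0 e0 r0.
Qed.

Lemma rank1_le e : r [set e] <= 1.
Proof. by have := rank_le_card [set e]; rewrite cards1. Qed.

Lemma coloop_sub Q X e :
  r (Q :\ e) < r Q -> X \subset Q -> e \in X -> r (X :\ e) < r X.
Proof.
move=> co sXQ eX; have := rank_diminish e (setSD [set e] sXQ).
by rewrite !setD1K ?(subsetP sXQ) //; lia.
Qed.

Lemma rank_all_coloops Q :
  (forall e, e \in Q -> r (Q :\ e) < r Q) -> r Q = #|Q|.
Proof.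
move=> co; apply: (@subset_ind (fun Y => r Y = #|Y|) set0);
  rewrite ?sub0set ?cards0 ?r0 // => e X _ sXQ eQ eX IH.
have sU : e |: X \subset Q by rewrite subUset sub1set eQ.
have := coloop_sub (co e eQ) sU (setU11 _ _); rewrite setU1K // IH cardsU1 eX.
by have := rank_U1_le rax e X; lia.
Qed.

Section Splitting.

Variables (Q : {set A}) (b : nat) (col : A -> nat).
Hypothesis spl : splitting r Q b col.

Lemma color_class_sub X c : color_class X col c \subset X.
Proof. by apply/subsetP => x; rewrite inE => /andP[]. Qed.

(** The excess of the summed class ranks over the rank is monotone, since a new element affects only
    its own class and [rank_diminish] compares the two increments. The excess is 0 at the empty set
    and at [Q], hence at everything between, which is [splitting_sub]. *)
Lemma splitting_gap X Y : X \subset Y -> Y \subset Q ->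
  \sum_(c < b) r (color_class X col c) + r Y
    <= \sum_(c < b) r (color_class Y col c) + r X.
Proof.
move=> sXY sYQ; apply: (@subset_ind (fun Y =>
  \sum_(c < b) r (color_class X col c) + r Y
    <= \sum_(c < b) r (color_class Y col c) + r X) _ _ sXY) => // e Z sXZ sZY eY eZ IH.
have lecb : col e < b by case: spl => h _ _; apply/h/(subsetP sYQ).
pose ce := Ordinal lecb.
have E W : \sum_(c < b) r (color_class W col c) = r (color_class W col (col e))
    + \sum_(c < b | c != ce) r (color_class W col c) by rewrite (bigD1 ce).
rewrite (E (e |: Z)); rewrite (E Z) in IH.
have -> : color_class (e |: Z) col (col e) = e |: color_class Z col (col e).
  by apply/setP => x; rewrite !inE; case: eqP => [->|]; rewrite ?eqxx.
have -> : \sum_(c < b | c != ce) r (color_class (e |: Z) col c)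
    = \sum_(c < b | c != ce) r (color_class Z col c); last first.
  by have := rank_diminish e (color_class_sub Z (col e)); move: IH; lia.
apply: eq_bigr => c ec; congr r; apply/setP => x; rewrite !inE; case: eqP => //= ->.
by rewrite (negbTE eZ) /=; apply/eqP => h; case/eqP: ec; apply/val_inj.
Qed.

Lemma splitting_sub X : X \subset Q -> \sum_(c < b) r (color_class X col c) = r X.
Proof.
move=> sXQ; have := splitting_gap sXQ (subxx Q).
have := splitting_gap (sub0set X) sXQ; case: (spl) => _ _ ->.
rewrite r0 [X in X + _ <= _]big1 => [|c _]; first by lia.
rewrite -r0; congr r; apply/setP => x; by rewrite !inE.
Qed.

Lemma splitting_class_compl X c : c < b -> X \subset Q ->
  r (color_class X col c) + r (X :\: color_class X col c) = r X.
Proof.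
move=> lcb sXQ; rewrite -(splitting_sub sXQ).
rewrite -(splitting_sub (X := X :\: _)); last first.
  exact: subset_trans (subsetDl _ _) sXQ.
rewrite (bigD1 (Ordinal lcb)) //= [in RHS](bigD1 (Ordinal lcb)) //=.
rewrite (_ : color_class (X :\: _) col c = set0) ?r0 ?add0n; last first.
  by apply/setP => x; rewrite !inE; case: (x \in X); case: eqP.
congr addn; apply: eq_bigr => c' cc'; congr r; apply/setP => x; rewrite !inE.
have c'c : val c' != c by apply/eqP => h; case/eqP: cc'; apply/val_inj.
by case: (x \in X) => //=; case: (eqVneq (col x) c') => [->|]; rewrite ?andbF // c'c.
Qed.

(** The part of [K] in the class of one of its elements splits off from [K], so it is all of [K]. *)
Lemma matroid_connected_class K : matroid_connected r K -> K \subset Q ->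
  exists2 c, c < b & K \subset color_class Q col c.
Proof.
case/andP=> /set0Pn[x xK] /forallP conn sKQ.
have lcb : col x < b by case: spl => h _ _; apply/h/(subsetP sKQ).
exists (col x) => //; have := conn (color_class K col (col x)).
rewrite color_class_sub splitting_class_compl // eqxx implybF.
rewrite (_ : color_class K _ _ != set0) /=; last first.
  by apply/set0Pn; exists x; rewrite inE xK eqxx.
rewrite negbK => /eqP {1}<-; apply/subsetP => y; rewrite !inE => /andP[yK ->].
by rewrite (subsetP sKQ).
Qed.

Lemma splitting_le_rank :
  (forall e, e \in Q -> r [set e] = 1) -> b <= r Q.
Proof.
case: spl => _ ne <- nl.
rewrite -{1}[b]card_ord -sum1_card; apply: leq_sum => c _.
have /set0Pn[x xc] := ne c (ltn_ord c).
rewrite -(nl x); first by apply: rank_mono; rewrite sub1set.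
by move: xc; rewrite inE => /andP[].
Qed.

(** Both sides differ by the rank of the other classes. For a singleton [X] this transfers being a
    coloop between [Q] and a class. *)
Lemma splitting_class_eq c X : c < b -> X \subset color_class Q col c ->
  r (Q :\: X) + r (color_class Q col c) = r (color_class Q col c :\: X) + r Q.
Proof.
move=> lcb sX.
rewrite -[in r Q](splitting_class_compl lcb (subxx Q)).
rewrite -[in r (Q :\: X)](splitting_class_compl lcb (subsetDl Q X)).
rewrite (_ : color_class (Q :\: X) col c = color_class Q col c :\: X); last first.
  by apply/setP => x; rewrite !inE andbA.
rewrite (_ : Q :\: X :\: _ = Q :\: color_class Q col c); first by lia.
apply/setP => x; rewrite !inE; have := subsetP sX x; rewrite inE.
by case: (x \in X) => /= [/(_ isT) ->|_]; rewrite ?andbF //; case: (x \in Q).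
Qed.

(** The point is that no class is emptied: if [e] were alone in its class, it would, as a nonloop,
    be a coloop of [Q]. *)
Lemma splitting_delete e : e \in Q -> r (Q :\ e) = r Q ->
  (forall e, e \in Q -> r [set e] = 1) -> splitting r (Q :\ e) b col.
Proof.
move=> eQ nco nl; case: (spl) => lb ne sumQ; split.
- by move=> x /setD1P[_ /lb].
- move=> c lcb; have /set0Pn[x xc] := ne c lcb; apply/set0Pn.
  case: (eqVneq x e) => [xe|xe]; last first.
    by exists x; move: xc; rewrite !inE xe.
  apply/set0Pn; apply/negP => /eqP h; subst x.
  have sC : [set e] \subset color_class Q col c by rewrite sub1set.
  have := splitting_class_eq lcb sC; rewrite nco.
  rewrite (_ : color_class Q col c :\: [set e] = set0) ?r0; last first.
    rewrite -h; apply/setP => x; rewrite !inE; by rewrite andbA.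
  by have := rank_mono sC; rewrite nl //; lia.
- exact: splitting_sub (subsetDl _ _).
Qed.

Lemma contract_class e c X : c < b -> c != col e -> e \in Q ->
  X \subset color_class Q col c -> contract r e X = r X.
Proof.
move=> lcb ce eQ sX; have le : col e < b by case: spl => h _ _; exact: h.
have sXQ : X \subset Q := subset_trans sX (color_class_sub _ _).
have sU : e |: X \subset Q by rewrite subUset sub1set eQ.
have := splitting_class_compl lcb sU.
rewrite (_ : color_class (e |: X) col c = X); last first.
  apply/setP => x; rewrite !inE; case: (eqVneq x e) => [->|xe] /=.
    rewrite eq_sym (negbTE ce); apply/esym/negP => /(subsetP sX).
    by rewrite inE eq_sym (negbTE ce) andbF.
  case: (boolP (x \in X)) => // /(subsetP sX); by rewrite inE => /andP[].
rewrite (_ : (e |: X) :\: X = [set e]) /contract => [<-|]; first by rewrite addnK.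
apply/setP => x; rewrite !inE; case: (boolP (x \in X)) => [xX|]; rewrite ?orbF //=.
case: eqP => // xe; subst x; move: (subsetP sX e xX); rewrite inE.
by rewrite eq_sym (negbTE ce) andbF.
Qed.

Lemma splitting_contract e : e \in Q -> r (Q :\ e) = r Q ->
  (forall e, e \in Q -> r [set e] = 1) -> splitting (contract r e) (Q :\ e) b col.
Proof.
move=> eQ nco nl; have [lb ne sumQ] := splitting_delete eQ nco nl; split=> //.
have le : col e < b by case: spl => h _ _; exact: h.
case: (spl) => _ _; rewrite (bigD1 (Ordinal le)) //= => sQ.
rewrite (bigD1 (Ordinal le)) //= [in RHS]/contract setD1K // nl // -sQ.
rewrite {1}/contract (_ : e |: _ = color_class Q col (col e)) ?nl //; last first.
  by apply/setP => x; rewrite !inE; case: (eqVneq x e) => [->|]; rewrite ?eQ ?eqxx.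
rewrite (eq_bigr (fun c : 'I_b => r (color_class Q col c))); last first.
  move=> c cce; have ce : val c != col e.
    by apply/eqP => h; case/eqP: cce; apply/val_inj.
  have E : color_class (Q :\ e) col c = color_class Q col c.
    apply/setP => x; rewrite !inE; case: (eqVneq x e) => //= ->.
    by rewrite eq_sym (negbTE ce) andbF.
  by rewrite E (contract_class (ltn_ord c)).
have : 1 <= r (color_class Q col (col e)).
  by rewrite -(nl e eQ); apply: rank_mono; rewrite sub1set inE eQ eqxx.
lia.
Qed.

Lemma splitting_refine c X : c < b -> X \subset color_class Q col c ->
  X != set0 -> X != color_class Q col c ->
  r X + r (color_class Q col c :\: X) = r (color_class Q col c) ->
  exists col', splitting r Q b.+1 col'.
Proof.
move=> lcb sX X0 XC rX; case: (spl) => lb ne sumQ.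
exists (fun x => if x \in X then b else col x).
have subX x : x \in X -> (x \in Q) /\ col x = c.
  by move=> /(subsetP sX); rewrite inE => /andP[? /eqP].
have cls c' : c' < b -> color_class Q (fun x => if x \in X then b else col x) c'
    = color_class Q col c' :\: X.
  move=> lc'; apply/setP => x; rewrite !inE; case: ifP => //= _.
  by rewrite gtn_eqF ?andbF.
have clsb : color_class Q (fun x => if x \in X then b else col x) b = X.
  apply/setP => x; rewrite inE; case: ifP => [/subX[-> _]|]; rewrite ?eqxx //.
  by move=> _; apply/negP => /andP[/lb h /eqP h']; rewrite h' ltnn in h.
have clsD c' : c' != c -> color_class Q col c' :\: X = color_class Q col c'.
  move=> cc'; apply/setP => x; rewrite !inE; case: (boolP (x \in X)) => //= xX.
  have [_ ->] := subX x xX; by rewrite eq_sym (negbTE cc') andbF.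
split.
- move=> x xQ; case: ifP => // _; exact: ltnW (lb x xQ).
- move=> c'; rewrite ltnS leq_eqVlt => /orP[/eqP ->|lc']; first by rewrite clsb.
  rewrite cls //; case: (eqVneq c' c) => [->|cc']; last by rewrite clsD // ne.
  by apply: contra XC => /eqP h; rewrite eqEsubset sX -setD_eq0 h eqxx.
- rewrite big_ord_recr /= clsb -sumQ (bigD1 (Ordinal lcb)) //=.
  rewrite [in RHS](bigD1 (Ordinal lcb)) //= cls // -rX.
  rewrite (eq_bigr (fun c : 'I_b => r (color_class Q col c))); first by lia.
  move=> c' cc'; by rewrite cls // clsD.
Qed.

End Splitting.

Lemma contract_rank e : r [set e] = 1 -> rank_axioms (contract r e).
Proof.
move=> e1; have ge X : 1 <= r (e |: X).
  by rewrite -e1; apply: rank_mono; apply: subsetUl.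
rewrite /contract e1; split=> [|f X|f X|f X Y sXY].
- by rewrite setU0 e1.
- by rewrite setUCA; apply: leq_sub2r; exact: rank_leU1.
- by rewrite setUCA -subSn // leq_sub2r // rank_U1_le.
- have sU : e |: X \subset e |: Y by exact: setUS.
  rewrite ![e |: (f |: _)]setUCA => h.
  by rewrite (rank_U1_sub rax f sU) //; move: h (ge X) (ge (f |: X));
    rewrite setUCA; lia.
Qed.

Lemma matroid_connected_coloop S e : matroid_connected r S -> e \in S ->
  r (S :\ e) < r S -> S = [set e].
Proof.
case/andP=> _ /forallP/(_ [set e]) conn eS co; apply/esym/eqP/negPn/negP => ne.
move: conn; rewrite sub1set eS ne andbT /= (_ : [set e] != set0) ?implyTb; last first.
  by apply/set0Pn; exists e; rewrite inE.
have := rank_U1_le rax e (S :\ e); have := rank_submod [set e] (S :\ e).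
by rewrite setD1K //; have := rank1_le e; lia.
Qed.

Lemma matroid_connected_nonloop S e : matroid_connected r S -> e \in S ->
  S != [set e] -> r [set e] = 1.
Proof.
move=> conn eS ne; have := rank1_le e; case E : (r [set e]) => [|[|//]] // _.
case/andP: conn => _ /forallP/(_ [set e]); rewrite sub1set eS [[set e] == S]eq_sym ne.
rewrite (_ : [set e] != set0); last by apply/set0Pn; exists e; rewrite inE.
by rewrite /= E add0n -(rank_loop_sub (S :\ e) E) setD1K // eqxx.
Qed.

(* Tutte: if A, B separate S \ e and C, D separate S / e then, by
   submodularity, one of A :&: C and B :&: D is empty, and one of A :&: D and
   B :&: C is, so that one of A, B, C, D is empty. *)
Lemma delete_or_contract_connected S e : matroid_connected r S -> e \in S ->
  r [set e] = 1 -> r (S :\ e) = r S ->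
  matroid_connected r (S :\ e) || matroid_connected (contract r e) (S :\ e).
Proof.
move=> /andP[_ /forallP conn] eS e1 nco.
have S0 : S :\ e != set0.
  apply/eqP => h; have := rank_mono (_ : [set e] \subset S).
  by rewrite sub1set eS e1 -nco h r0 => /(_ isT).
rewrite /matroid_connected S0 /=; apply/negPn/negP; rewrite negb_or !negb_forall.
case/andP=> /existsP[X]; rewrite negb_imply negbK => /andP[/and3P[sX X0 XS] /eqP rX].
move=> /existsP[C]; rewrite negb_imply negbK => /andP[/and3P[sC C0 CS] /eqP rC].
set Y := S :\ e :\: X in rX; set D := S :\ e :\: C in rC.
have ge Z : 1 <= r (e |: Z) by rewrite -e1; apply: rank_mono; apply: subsetUl.
have rC' : r (e |: C) + r (e |: D) = r S + 1.
  move: rC; rewrite /contract setD1K // e1; have := ge C; have := ge D.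
  have := rank_mono (_ : [set e] \subset S); rewrite sub1set eS e1 => /(_ isT).
  by clear; lia.
have eX : e \notin X by apply/negP => /(subsetP sX); rewrite !inE eqxx.
have eC : e \notin C by apply/negP => /(subsetP sC); rewrite !inE eqxx.
have sXS : X \subset S := subset_trans sX (subsetDl _ _).
have sCS : C \subset S := subset_trans sC (subsetDl _ _).
(* Connectedness of [S] is applied to the intersection, whose complement in [S] contains [e]; the
   strict inequality yields the extra 1. *)
have key (X' C' : {set A}) :
    e \notin X' -> X' \subset S -> e \notin C' -> C' \subset S -> X' :&: C' != set0 ->
    r S + 1 <= r (X' :&: C') + r (e |: (S :\ e :\: X') :|: (S :\ e :\: C')).
  move=> eX' sX' eC' sC' n0.
  have sI : X' :&: C' \subset S by apply: subset_trans (subsetIl _ _) sX'.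
  have := conn (X' :&: C'); rewrite sI n0 /=.
  rewrite (_ : X' :&: C' != S) /=; last first.
    by apply/negP => /eqP h; move: eS; rewrite -h inE (negbTE eX').
  rewrite (_ : S :\: _ = e |: (S :\ e :\: X') :|: (S :\ e :\: C')).
    move=> /eqP.
    set V := e |: _ :|: _; set W := X' :&: C' => ne.
    have : r S <= r (W :|: V).
      apply: rank_mono; apply/subsetP => z zS; rewrite !inE zS.
      by case: (z == e); case: (z \in X'); case: (z \in C').
    have := rank_submod W V; move: (r V) (r W) (r S) (r (W :|: V)) (r _) ne.
    by clear; move=> *; lia.
  apply/setP => z; rewrite !inE negb_and; case: (eqVneq z e) => [->|_] /=.
    by rewrite eX' eS.
  by rewrite -andb_orl.
have sYS : Y \subset S by rewrite /Y; apply: subset_trans (subsetDl _ _) (subsetDl _ _).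
have sDS : D \subset S by rewrite /D; apply: subset_trans (subsetDl _ _) (subsetDl _ _).
have eY : e \notin Y by rewrite !inE eqxx /= andbF.
have eD : e \notin D by rewrite !inE eqxx /= andbF.
have YK : S :\ e :\: Y = X by rewrite /Y setDDr setDv set0U; apply/setIidPr.
have DK : S :\ e :\: D = C by rewrite /D setDDr setDv set0U; apply/setIidPr.
(* If both intersections were nonempty, the two instances of [key] would add up to at least 2 r(S) +
   2, while submodularity for [X'], [e |: C'] and for [Y'], [e |: D'] bounds the sum by 2 r(S) +
   1. *)
have cross (X' Y' C' D' : {set A}) :
    e \notin X' -> X' \subset S -> e \notin C' -> C' \subset S ->
    e \notin Y' -> Y' \subset S -> e \notin D' -> D' \subset S ->
    S :\ e :\: X' = Y' -> S :\ e :\: Y' = X' ->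
    S :\ e :\: C' = D' -> S :\ e :\: D' = C' ->
    r X' + r Y' = r S -> r (e |: C') + r (e |: D') = r S + 1 ->
    (X' :&: C' == set0) || (Y' :&: D' == set0).
  move=> eX' sX' eC' sC' eY' sY' eD' sD' EX EY EC ED r1 r2.
  apply/negPn/negP; rewrite negb_or => /andP[n1 n2].
  have := key _ _ eX' sX' eC' sC' n1; have := key _ _ eY' sY' eD' sD' n2.
  rewrite EX EY EC ED.
  have := rank_submod X' (e |: C'); have := rank_submod Y' (e |: D').
  have I1 Z W : e \notin Z -> Z :&: (e |: W) = Z :&: W.
    move=> eZ; apply/setP => z; rewrite !inE; case: (eqVneq z e) => [->|] //=.
    by rewrite (negbTE eZ).
  rewrite !I1 // [X' :|: (e |: _)]setUCA [Y' :|: (e |: _)]setUCA -!setUA.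
  by move: r1 r2; clear; lia.
have h1 := cross X Y C D eX sXS eC sCS eY sYS eD sDS erefl YK erefl DK
  (etrans rX nco) rC'.
have h2 := cross X Y D C eX sXS eD sDS eY sYS eC sCS erefl YK DK erefl
  (etrans rX nco) (etrans (addnC _ _) rC').
have split_set Z W V : Z \subset S -> e \notin Z -> S :\ e :\: W = V ->
    Z :&: W == set0 -> Z :&: V == set0 -> Z = set0.
  move=> /subsetP sZ eZ <- /eqP/setP z1 /eqP/setP z2; apply/setP => z.
  rewrite in_set0; apply/negP => zZ; move: (z1 z) (z2 z); rewrite !inE zZ /=.
  move=> -> /=; rewrite sZ // andbT => /negbFE/eqP ze.
  by rewrite ze (negbTE eZ) in zZ.
have Y0 : Y != set0.
  by apply: contra XS; rewrite setD_eq0 => h; rewrite eqEsubset sX.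
have D0 : D != set0.
  by apply: contra CS; rewrite setD_eq0 => h; rewrite eqEsubset sC.
case/orP: h1 => h1; case/orP: h2 => h2.
- by rewrite (split_set X C D) ?eqxx in X0.
- by rewrite (split_set C X Y) ?eqxx // setIC in C0.
- by rewrite (split_set D X Y) ?eqxx // setIC in D0.
- by rewrite (split_set Y D C) ?eqxx in Y0.
Qed.

End Rank.

(** Disconnected classes are refined; this stops because nonempty classes number at most [#|Q|]. The
    empty [Q] starts with b = 0, as a single class would be empty. *)
Lemma exists_connected_splitting r Q : rank_axioms r ->
  exists b col, splitting r Q b col /\
    (forall c, c < b -> matroid_connected r (color_class Q col c)).
Proof.
move=> rax; have base : exists b col, splitting r Q b col.
  case: (eqVneq Q set0) => [->|Q0].
    exists 0, (fun=> 0); split=> [x|//|]; first by rewrite inE.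
    by rewrite big_ord0 rank0.
  have clsQ : color_class Q (fun=> 0) 0 = Q.
    by apply/setP => x; rewrite !inE andbT.
  exists 1, (fun=> 0); split=> // [[|//] _|]; first by rewrite clsQ.
  by rewrite big_ord1 clsQ.
have le_card b col : splitting r Q b col -> b <= #|Q|.
  case=> lb ne _; rewrite -[b]card_ord.
  have pick (c : 'I_b) : exists x, x \in color_class Q col c.
    by have /set0Pn := ne c (ltn_ord c).
  have [g gP] := choice pick.
  have /card_in_imset <- : {in 'I_b &, injective g}.
    move=> c c' _ _ gg; apply/val_inj; move: (gP c) (gP c'); rewrite gg !inE.
    by move=> /andP[_ /eqP e1] /andP[_ /eqP e2]; exact: etrans (esym e1) e2.
  apply: subset_leq_card; apply/subsetP => _ /imsetP[c _ ->].
  by have := gP c; rewrite inE => /andP[].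
case: base => b [col].
have [n] := ubnP (#|Q| - b); elim: n b col => // n IH b col le_n spl.
have [/forallP conn|] :=
  boolP [forall c : 'I_b, matroid_connected r (color_class Q col c)].
  by exists b, col; split=> // c lc; exact: (conn (Ordinal lc)).
rewrite negb_forall => /existsP[c]; case: (spl) => _ ne _.
rewrite /matroid_connected ne //= negb_forall => /existsP[X].
rewrite negb_imply negbK => /andP[/and3P[sX X0 XC] /eqP rX].
have [col' spl'] := splitting_refine rax spl (ltn_ord c) sX X0 XC rX.
apply: (IH b.+1 col') => //; have := le_card _ _ spl'; lia.
Qed.

End Matroid.

(** * Components and the cycle matroid *)

Section Components.

Variable T : finType.
Implicit Types (F P Q : {set {set T}}) (e C D : {set T}) (x y u v : T).

Definition cls F x : {set T} := [set y | connect (adj F) x y].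
Definition kappa F := #|components F|.
(** The rank of [F] in the cycle matroid of the graph with [P] contracted: the number of components
    lost by adding [F] to [P]. *)
Definition cycle_rank P F := kappa P - kappa (P :|: F).

Lemma adj_sym F : symmetric (adj F).
Proof. by move=> x y; rewrite /adj /= setUC. Qed.

Lemma connectC F x y : connect (adj F) x y = connect (adj F) y x.
Proof. exact/sym_connect_sym/adj_sym. Qed.

Lemma connect_mono F F' x y :
  F \subset F' -> connect (adj F) x y -> connect (adj F') x y.
Proof.
move=> /subsetP sF; apply: connect_sub => a b /= h; apply: connect1; exact: sF.
Qed.

Lemma mem_cls F x : x \in cls F x.
Proof. by rewrite inE connect0. Qed.

Lemma cls_eq F x y : y \in cls F x -> cls F y = cls F x.
Proof.
rewrite inE => xy; apply/setP => z; rewrite !inE.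
exact/esym/(same_connect (connectC F)).
Qed.

Lemma cls_eqE F x y : (cls F x == cls F y) = connect (adj F) x y.
Proof.
apply/eqP/idP => [h|xy]; last by apply/esym/cls_eq; rewrite inE.
by have := mem_cls F y; rewrite -h inE.
Qed.

Lemma componentsP F C :
  reflect (exists x, C = cls F x) (C \in components F).
Proof.
apply: (iffP imsetP) => [[x _ ->]|[x ->]]; exists x => //;
  by apply/setP => y; rewrite !inE.
Qed.

Lemma cls_component F x : cls F x \in components F.
Proof. by apply/componentsP; exists x. Qed.

Lemma component_cls F C x : C \in components F -> x \in C -> C = cls F x.
Proof. by case/componentsP=> y ->; move/cls_eq. Qed.

Lemma component_ex F C : C \in components F -> exists x, x \in C.
Proof. by case/componentsP=> y ->; exists y; exact: mem_cls. Qed.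

(** These are the unions of components of [F], the sets on which label sums can be regrouped. *)
Definition saturated F (X : {set T}) :=
  forall x y, connect (adj F) x y -> x \in X -> y \in X.

Lemma saturated_cls F F' x : F \subset F' -> saturated F (cls F' x).
Proof.
by move=> s y z; rewrite !inE => /(connect_mono s) yz xy; apply: connect_trans yz.
Qed.

Lemma saturatedT F : saturated F [set: T].
Proof. by move=> x y; rewrite inE. Qed.

Lemma saturated_mono F F' X : F \subset F' -> saturated F' X -> saturated F X.
Proof. by move=> s h x y /(connect_mono s); exact: h. Qed.

Lemma component_subE F D X x : saturated F X -> D \in components F -> x \in D ->
  (D \subset X) = (x \in X).
Proof.
move=> sat DF xD; apply/idP/idP => [/subsetP/(_ x xD) //|xX].
rewrite (component_cls DF xD); apply/subsetP => z; rewrite inE => xz.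
exact: sat xz xX.
Qed.

(** Each component of the smaller graph lies in exactly one of the larger. This regrouping makes
    successive merges of labels agree with merging at once. *)
Lemma components_sum F F' X (g : {set T} -> nat) :
  F \subset F' -> saturated F' X ->
  \sum_(C in components F' | C \subset X)
     \sum_(D in components F | D \subset C) g D
  = \sum_(D in components F | D \subset X) g D.
Proof.
move=> s1 sat; have satF := saturated_mono s1 sat.
rewrite (exchange_big_dep (fun D => (D \in components F) && (D \subset X))) /=.
  apply: eq_bigr => D /andP[DF sD]; have [x xD] := component_ex DF.
  rewrite (big_pred1 (cls F' x)) // => C /=; apply/idP/eqP.
    case/andP=> /andP[CF _] /andP[_ /subsetP/(_ x xD)].
    exact: component_cls.
  move=> ->; rewrite cls_component DF (component_subE (@saturated_cls _ _ x s1) DF xD).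
  rewrite mem_cls (component_subE sat (cls_component F' x) (mem_cls F' x)).
  by rewrite (subsetP sD).
move=> C D /andP[_ sC] /andP[-> sD] /=; exact: subset_trans sC.
Qed.

Lemma connectU1 F u v x y : connect (adj ([set u; v] |: F)) x y =
  [|| connect (adj F) x y, connect (adj F) x u && connect (adj F) v y
    | connect (adj F) x v && connect (adj F) u y].
Proof.
have sF : F \subset [set u; v] |: F by exact: subsetUr.
have uv : connect (adj ([set u; v] |: F)) u v by apply: connect1; rewrite /adj /= setU11.
apply/idP/idP; last first.
  case/or3P => [|/andP[xu vy]|/andP[xv uy]]; first exact: connect_mono.
    apply: connect_trans (connect_mono sF xu) (connect_trans uv _).
    exact: connect_mono vy.
  apply: connect_trans (connect_mono sF xv) _; rewrite connectC in uv.
  exact: connect_trans uv (connect_mono sF uy).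
case/connectP=> p pth ->; elim: p x pth => [|z p IH] x /=; first by rewrite connect0.
case/andP=> xz /IH {IH}; set w := last z p => h.
move: xz; rewrite /adj /= in_setU1 => /orP[/eqP xzE|xz]; last first.
  have xz' : connect (adj F) x z by apply: connect1.
  by case/or3P: h => [zw|/andP[zu vw]|/andP[zv uw]]; apply/or3P;
    [apply: Or31|apply: Or32|apply: Or33]; rewrite ?(connect_trans xz') //;
    rewrite (connect_trans xz') ?zu ?zv.
have : (x \in [set u; v]) && (z \in [set u; v]) by rewrite -xzE !inE !eqxx orbT.
rewrite !inE => /andP[/orP[]/eqP-> /orP[]/eqP ze]; move: h; rewrite ze !connect0;
  by case: (connect _ u w); case: (connect _ v w); rewrite ?andbT ?andbF ?orbT ?orbF.
Qed.

Lemma eq_components F F' : (forall x y, connect (adj F) x y = connect (adj F') x y) ->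
  components F = components F'.
Proof.
move=> h; apply/setP => C; apply/componentsP/componentsP => -[x ->]; exists x;
  by apply/setP => y; rewrite !inE h.
Qed.

Lemma components_joined F u v : connect (adj F) u v ->
  components ([set u; v] |: F) = components F.
Proof.
move=> uv; apply: eq_components => x y; rewrite connectU1.
case: (boolP (connect _ x y)) => //= xy; apply/negP => /orP[]/andP[h1 h2];
  case/negP: xy.
  exact: connect_trans h1 (connect_trans uv h2).
rewrite connectC in uv; exact: connect_trans h1 (connect_trans uv h2).
Qed.

(** Edges are so far arbitrary vertex sets; one that is not of the form [[set u; v]] joins nothing
    and behaves as a loop. *)
Lemma components_other F e : (forall u v, e != [set u; v]) ->
  components (e |: F) = components F.
Proof.
move=> ne; apply: eq_components => x y; apply: eq_connect => a b.
by rewrite /adj /= in_setU1 eq_sym (negbTE (ne _ _)).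
Qed.

Lemma kappa_merge F u v : ~~ connect (adj F) u v ->
  kappa F = (kappa ([set u; v] |: F)).+1.
Proof.
move=> nuv; set F' := [set u; v] |: F.
have cu x : connect (adj F) x u || connect (adj F) x v -> cls F' x = cls F u :|: cls F v.
  move=> h; apply/setP => y; rewrite !inE connectU1.
  case/orP: h => xe; rewrite !(same_connect (connectC F) xe) connect0.
    by rewrite (negbTE nuv) orbF.
  by rewrite (connectC F v u) (negbTE nuv) /= orbC.
have nu x : ~~ (connect (adj F) x u || connect (adj F) x v) -> cls F' x = cls F x.
  rewrite negb_or => /andP[/negbTE xu /negbTE xv]; apply/setP => y.
  by rewrite !inE connectU1 xu xv orbF.
pose R := components F :\: [set cls F u; cls F v].
have E1 : components F = cls F u |: (cls F v |: R).
  apply/setP => C; rewrite !inE; case: eqP => [->|]; rewrite ?cls_component //=.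
  by case: eqP => [->|]; rewrite ?cls_component.
have E2 : components F' = (cls F u :|: cls F v) |: R.
  apply/setP => C; rewrite in_setU1; apply/idP/idP.
    case/componentsP=> x ->; case: (boolP (connect (adj F) x u || connect (adj F) x v)).
      by move/cu ->; rewrite eqxx.
    move=> h; rewrite (nu _ h) !inE !cls_eqE h cls_component; exact: orbT.
  case/orP => [/eqP ->|]; first by rewrite -(cu u) ?connect0 // cls_component.
  rewrite !inE => /andP[h /componentsP[x Ex]]; move: h; rewrite Ex !cls_eqE.
  by move/nu <-; rewrite cls_component.
have nR : cls F u :|: cls F v \notin R.
  rewrite !inE; apply/negP => /andP[h1 /componentsP[x Ex]].
  have : u \in cls F x by rewrite -Ex !inE connect0.
  move/cls_eq => Eu; case/negP: h1.
  by rewrite Ex -Eu eqxx.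
by rewrite /kappa E1 E2 !cardsU1 nR !inE !eqxx orbT /= !cls_eqE (negbTE nuv).
Qed.

Lemma edge_cases e F : (kappa (e |: F) = kappa F /\ components (e |: F) = components F)
  \/ (exists u v, [/\ e = [set u; v], ~~ connect (adj F) u v
                    & kappa F = (kappa (e |: F)).+1]).
Proof.
have [/existsP[u /existsP[v /eqP ->]]|h] := boolP [exists u, exists v, e == [set u; v]].
  have [uv|uv] := boolP (connect (adj F) u v).
    by left; rewrite /kappa components_joined.
  by right; exists u, v; split => //; exact: kappa_merge.
left; rewrite /kappa components_other // => u v.
by apply: contra h => h; apply/existsP; exists u; apply/existsP; exists v.
Qed.

Lemma kappaU1_sub F F' e :
  F \subset F' -> kappa (e |: F) = kappa F -> kappa (e |: F') = kappa F'.
Proof.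
move=> sF; case: (edge_cases e F') => [[-> //]|[u [v [-> nuv _]]]].
have nuv' : ~~ connect (adj F) u v by apply: contra nuv; exact: connect_mono.
by rewrite (kappa_merge nuv') => /n_Sn.
Qed.

Lemma kappaU1 F e : kappa (e |: F) <= kappa F <= (kappa (e |: F)).+1.
Proof. by case: (edge_cases e F) => [[-> _]|[u [v [_ _ ->]]]]; lia. Qed.

Lemma kappa_anti F F' : F \subset F' -> kappa F' <= kappa F.
Proof.
move=> s; apply: (@subset_ind _ (fun F' => kappa F' <= kappa F) _ _ s) => //.
by move=> e Z _ _ _ _ h; apply: leq_trans h; case/andP: (kappaU1 Z e).
Qed.

Lemma cycle_rank_axioms P : rank_axioms (cycle_rank P).
Proof.
have h e X : P :|: (e |: X) = e |: (P :|: X) by rewrite setUCA.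
have ka X : kappa (P :|: X) <= kappa P := kappa_anti (subsetUl P X).
split=> [|e X|e X|e X Y sXY]; rewrite /cycle_rank ?setU0 ?subnn // h.
- by apply: leq_sub2l; case/andP: (kappaU1 (P :|: X) e).
- by case/andP: (kappaU1 (P :|: X) e) (ka X) => _; move: (kappa _) (kappa _) (kappa _);
    clear; lia.
- move=> E; rewrite h (kappaU1_sub (setUS P sXY)) //.
  case/andP: (kappaU1 (P :|: X) e) (ka X) => + _; move: E.
  by move: (kappa _) (kappa _) (kappa _); clear; lia.
Qed.

Lemma cycle_rank_contract P e : contract (cycle_rank P) e = cycle_rank (e |: P).
Proof.
apply/funext => X; rewrite /contract /cycle_rank.
have -> : P :|: (e |: X) = (e |: P) :|: X by rewrite setUA [P :|: _]setUC.
have -> : P :|: [set e] = e |: P by rewrite setUC.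
case/andP: (kappaU1 P e) (kappa_anti (subsetUl (e |: P) X)) => + _.
by move: (kappa _) (kappa _) (kappa _); clear; lia.
Qed.

End Components.

(** * Enhanced states *)

Section States.

Variables (T : finType) (m : nat) (E : {set {set T}}) (le : rel {set T}).
Hypothesis le_total : total_order_on E le.

Notation state := (state m E).
Implicit Types (s t u : state) (F P Q : {set {set T}}) (e f C : {set T}) (x y : T).

Definition cls_of (H : spanning E) x : component H :=
  exist _ (cls (val H) x) (cls_component (val H) x).

(** The type of components depends on the edge set, so labels of different states are compared
    through vertices. *)
Definition labv s x : nat := label s (cls_of (tag s) x).

Definition lab s C : nat := if [pick x in C] is Some x then labv s x else 0.

(** The exponent, before truncation by x^m, of the product of the labels of the components inside
    [X]. *)
Definition weight s (X : {set T}) : nat :=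
  \sum_(C in components (sedges s) | C \subset X) lab s C.

Lemma sedges_sub s : sedges s \subset E.
Proof. exact: (valP (tag s)). Qed.

Lemma labv_lt s x : labv s x < m.
Proof. exact: ltn_ord. Qed.

Lemma component_label s (C : component (tag s)) x :
  x \in val C -> label s C = labv s x :> nat.
Proof.
move=> xC; have -> // : C = cls_of (tag s) x.
exact/val_inj/(component_cls (valP C) xC).
Qed.

Lemma labv_connect s x y : connect (adj (sedges s)) x y -> labv s x = labv s y.
Proof.
by move=> xy; have := @component_label s (cls_of (tag s) x) y; rewrite /= inE => /(_ xy).
Qed.

Lemma lab_component s C x : C \in components (sedges s) -> x \in C -> lab s C = labv s x.
Proof.
move=> Cs xC; rewrite /lab; case: pickP => [y yC|/(_ x)]; last by rewrite xC.
by apply: labv_connect; move: xC; rewrite (component_cls Cs yC) inE.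
Qed.

Lemma lab_cls s x : lab s (cls (sedges s) x) = labv s x.
Proof. by rewrite (lab_component (cls_component _ x) (mem_cls _ x)). Qed.

Lemma labelE s (C : component (tag s)) : label s C = lab s (val C) :> nat.
Proof.
have [x xC] := component_ex (valP C).
by rewrite (component_label xC) (lab_component (valP C) xC).
Qed.

Lemma weight_cls s x : weight s (cls (sedges s) x) = labv s x.
Proof.
rewrite /weight (big_pred1 (cls (sedges s) x)) ?lab_cls // => C /=.
apply/idP/eqP => [/andP[Cs sC]|->]; last by rewrite cls_component subxx.
have [y yC] := component_ex Cs; rewrite (component_cls Cs yC).
exact/cls_eq/(subsetP sC).
Qed.

Lemma qdeg_weight s : qdeg s = weight s [set: T].
Proof.
rewrite /weight big_sub_cond /=; rewrite /qdeg.
by apply: eq_big => [C|C _]; rewrite ?subsetT // labelE.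
Qed.

Lemma state_ext s t : sedges s = sedges t -> labv s =1 labv t -> s = t.
Proof.
case: s t => [H l] [K k]; rewrite /sedges /= => /val_inj HK; subst K => h.
congr existT; apply/ffunP => C; have [x xC] := component_ex (valP C).
apply/val_inj; have := h x.
by rewrite -[labv _ _](component_label (s := existT _ H l) xC)
  -[in RHS](component_label (s := existT _ H k) xC).
Qed.

Lemma state_ex F (g : T -> nat) : F \subset E -> (forall x, g x < m) ->
  (forall x y, connect (adj F) x y -> g x = g y) ->
  exists s, sedges s = F /\ labv s =1 g.
Proof.
move=> sF gm gc; pose H : spanning E := exist _ F sF.
pose pk (C : component H) := xchoose (component_ex (valP C)).
pose s : state := existT _ H [ffun C : component H => Ordinal (gm (pk C))].
exists s; split=> // x; rewrite /labv /label /= ffunE /=; apply: gc.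
have := xchooseP (component_ex (valP (cls_of H x))).
by rewrite /= inE connectC.
Qed.

(** [t] arises from [s] by adding edges and multiplying labels without reaching x^m. The arrows of
    [d] are the pairs in this relation that differ by one edge. *)
Definition sle s t :=
  (sedges s \subset sedges t) &&
  [forall x, labv t x == weight s (cls (sedges t) x)].

Lemma sleP s t : reflect (sedges s \subset sedges t /\
  forall x, labv t x = weight s (cls (sedges t) x)) (sle s t).
Proof.
apply: (iffP andP) => -[sE h]; split=> //; first by move=> x; exact/eqP/(forallP h).
by apply/forallP => x; apply/eqP.
Qed.

Lemma weight_sle s t X : sle s t -> saturated (sedges t) X -> weight t X = weight s X.
Proof.
case/sleP=> sE h sat; rewrite -[RHS](components_sum _ sE sat).
apply: eq_bigr => C /andP[Ct _]; have [x xC] := component_ex Ct.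
by rewrite (lab_component Ct xC) h (component_cls Ct xC).
Qed.

Lemma sle_qdeg s t : sle s t -> qdeg s = qdeg t.
Proof. by move=> h; rewrite !qdeg_weight (weight_sle h) //; exact: saturatedT. Qed.

Lemma sle_trans s t u : sle s t -> sle t u -> sle s u.
Proof.
move=> st /sleP[tu h]; have /sleP[sE _] := st; apply/sleP; split.
  exact: subset_trans tu.
by move=> x; rewrite h (weight_sle st) //; exact: saturated_cls.
Qed.

Lemma sle_uniq s t t' : sle s t -> sle s t' -> sedges t = sedges t' -> t = t'.
Proof.
move=> /sleP[_ h] /sleP[_ h'] tt'; apply: state_ext => // x.
by rewrite h h' tt'.
Qed.

Lemma weight_mono s (X Y : {set T}) : X \subset Y -> weight s X <= weight s Y.
Proof.
move=> sXY; rewrite /weight [X in _ <= X](bigID (fun C => C \subset X)) /=.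
rewrite (eq_bigl (fun C => [&& C \in components (sedges s), C \subset Y & C \subset X])).
  by under [X in _ <= X + _]eq_bigl => C do rewrite -andbA; rewrite leq_addr.
move=> C; case: (C \in _) => //=; case: (boolP (C \subset X)) => [h|]; last by rewrite andbF.
by rewrite (subset_trans h).
Qed.

Lemma sle_ex s F : sedges s \subset F -> F \subset E ->
  (forall x, weight s (cls F x) < m) -> exists t, sle s t /\ sedges t = F.
Proof.
move=> sF FE wm; have [|t [tF lt]] := @state_ex F (fun x => weight s (cls F x)) FE wm.
  by move=> x y; rewrite -cls_eqE => /eqP ->.
by exists t; split=> //; apply/sleP; rewrite tF.
Qed.

(** Merging only raises exponents, so those of the intermediate state are bounded by exponents of
    [u] and no product vanishes on the way. *)
Lemma sle_between s u F : sle s u -> sedges s \subset F -> F \subset sedges u ->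
  exists t, [/\ sle s t, sle t u & sedges t = F].
Proof.
move=> su sF Fu; have /sleP[_ lu] := su.
have [|t [st tF]] := sle_ex sF (subset_trans Fu (sedges_sub u)).
  move=> x; apply: leq_ltn_trans (labv_lt u x); rewrite lu; apply: weight_mono.
  by apply/subsetP => y; rewrite !inE; exact: connect_mono.
exists t; split=> //; apply/sleP; rewrite tF; split=> // x.
rewrite lu (weight_sle st) // tF; exact: saturated_cls.
Qed.

Lemma adds_edgeE e s t :
  adds_edge e s t = (sedges t == e |: sedges s) && sle s t.
Proof.
rewrite /adds_edge; case: eqP => //= st.
rewrite /sle st subsetUr /=; apply/forallP/forallP => h.
  move=> x; have := h (cls_of (tag t) x); rewrite -/(labv t x) => /eqP ->.
  rewrite /weight -st big_sub_cond /=.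
  by apply/eqP; apply: eq_bigr => C _; rewrite labelE.
move=> C; have [x xC] := component_ex (valP C).
have := h x; rewrite -(component_label xC) => /eqP ->.
rewrite -st -(component_cls (valP C) xC) /weight big_sub_cond /=.
by apply/eqP; apply: eq_bigr => D _; rewrite labelE.
Qed.

Local Open Scope ring_scope.

Definition dcoef s t : int := d_state le s t.

Definition sgn e s : int := (-1) ^+ #|edges_before le e s|.

Lemma dcoefE s t : dcoef s t =
  \sum_(e in E :\: sedges s) (adds_edge e s t)%:R * sgn e s.
Proof.
rewrite /dcoef /d_state sum_ffunE; apply: eq_bigr => e _.
by rewrite ffunMzE ffunE mulrzz.
Qed.

Lemma dcoef_cover e s t : e \notin sedges s -> sedges t = e |: sedges s -> sle s t ->
  dcoef s t = sgn e s.
Proof.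
move=> es te st; rewrite dcoefE (bigD1 e) /=; last first.
  by rewrite inE es (subsetP (sedges_sub t)) // te setU11.
rewrite adds_edgeE te eqxx st mul1r big1 ?addr0 // => f /andP[fs fe].
rewrite adds_edgeE te (_ : _ == _ = false) ?mul0r //.
apply/negP => /eqP/setP/(_ f); rewrite !inE eqxx (negbTE fe) /=.
by move: fs; rewrite inE => /andP[/negbTE ->].
Qed.

Lemma dcoef_neq0 s t : dcoef s t != 0 ->
  sle s t /\ exists e, e \notin sedges s /\ sedges t = e |: sedges s.
Proof.
move=> h; have [/exists_inP[e eE]|/exists_inPn h1] :=
    boolP [exists e in E :\: sedges s, adds_edge e s t].
  rewrite adds_edgeE => /andP[/eqP te st]; split=> //; exists e; split=> //.
  by move: eE; rewrite inE => /andP[].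
case/eqP: h; rewrite dcoefE big1 // => e /h1 /negbTE ->; exact: mul0r.
Qed.

Lemma dcoefP s t : dcoef s t != 0 <->
  sle s t /\ exists e, e \notin sedges s /\ sedges t = e |: sedges s.
Proof.
split; first exact: dcoef_neq0.
case=> st [e [es te]]; rewrite (dcoef_cover es te st) /sgn.
by rewrite expf_eq0 oppr_eq0 oner_eq0 andbF.
Qed.

Lemma dcoef_sqr s t : dcoef s t != 0 -> dcoef s t * dcoef s t = 1.
Proof.
by case/dcoefP=> st [e [es te]]; rewrite (dcoef_cover es te st) /sgn -expr2 sqrr_sign.
Qed.

Lemma dcoef_hdeg s t : dcoef s t != 0 -> hdeg t = (hdeg s).+1.
Proof. by case/dcoefP=> _ [e [es te]]; rewrite /hdeg te cardsU1 es. Qed.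

Lemma sgnU1 e f s t : e \in E -> e != f -> e \notin sedges s ->
  sedges t = e |: sedges s ->
  sgn f t = if le e f then - sgn f s else sgn f s.
Proof.
move=> eE ef es te; rewrite /sgn.
have : edges_before le f t =
    if le e f then e |: edges_before le f s else edges_before le f s.
  apply/setP => g; rewrite inE te in_setU1.
  case: ifP => lef; rewrite !inE; case: (eqVneq g e) => [->|] //=.
    by rewrite ef lef.
  by rewrite ef lef (negbTE es).
move=> ->; case: ifP => // _; rewrite cardsU1 inE (negbTE es) /= exprS.
by rewrite mulN1r.
Qed.

Definition sle_convex (U : {set state}) :=
  forall s t u, s \in U -> u \in U -> sle s t -> sle t u -> t \in U.

(** Two states two edges apart have exactly two states between them, one for each order of adding
    the edges. Convexity puts both in [U], and their signs are opposite because exactly one of the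
    two edges precedes the other. *)
Lemma dcoef_complex (U : {set state}) : sle_convex U -> is_complex dcoef U.
Proof.
move=> cvx s u sU uU.
have [/exists_inP[t tU nz]|/exists_inPn h] :=
    boolP [exists t in U, dcoef s t * dcoef t u != 0]; last first.
  by apply: big1 => t tU; apply/eqP; rewrite -[_ == _]negbK h.
move: nz; rewrite mulf_eq0 negb_or => /andP[].
case/dcoefP=> st [e [es te]] /dcoefP[tu [f [ft uf]]].
have su := sle_trans st tu.
have fs : f \notin sedges s by apply: contra ft; rewrite te inE => ->; rewrite orbT.
have fe : f != e by apply: contra ft => /eqP ->; rewrite te setU11.
have uE : sedges u = e |: (f |: sedges s) by rewrite uf te setUCA.
have [||t' [st' t'u t'f]] := @sle_between s u (f |: sedges s) su.
- exact: subsetUr.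
- by rewrite uE subsetUr.
have et' : e \notin sedges t' by rewrite t'f !inE negb_or es eq_sym fe.
have tt' : t' != t.
  by apply/eqP => h; move: et'; rewrite h te setU11.
have t'U : t' \in U by exact: (cvx s t' u).
rewrite (bigD1 t) //= (bigD1 t') //=; last by rewrite t'U.
rewrite [X in _ + (_ + X)]big1 => [|v /andP[/andP[vU vt] vt']]; last first.
  apply/eqP/negPn/negP; rewrite mulf_eq0 negb_or => /andP[].
  case/dcoefP=> sv [g [gs vg]] /dcoefP[vu _].
  have /sleP[/subsetP/(_ g) + _] := vu; rewrite vg uE setU11 => /(_ isT).
  rewrite !inE (negbTE gs) orbF => /orP[]/eqP ge.
    by case/eqP: vt; apply: (sle_uniq sv st); rewrite vg te ge.
  by case/eqP: vt'; apply: (sle_uniq sv st'); rewrite vg t'f ge.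
have eE : e \in E by apply: (subsetP (sedges_sub t)); rewrite te setU11.
have fE : f \in E by apply: (subsetP (sedges_sub u)); rewrite uf setU11.
rewrite [X in _ + X]addr0 (dcoef_cover es te st) (dcoef_cover ft uf tu).
rewrite (dcoef_cover fs t'f st') (dcoef_cover et' _ t'u); last by rewrite uE t'f.
rewrite (sgnU1 eE _ es te) 1?eq_sym // (sgnU1 fE fe fs t'f).
have [_ anti _ tot] := le_total.
have := tot e f eE fE; have := anti e f eE fE.
case: (le e f); case: (le f e) => /= an to //.
- by case/eqP: fe; rewrite an.
- by rewrite mulrN mulrC addNr.
- by rewrite mulrN [_ * sgn e s]mulrC addrN.
Qed.

Lemma dE (c : chain m E) t : d le c t = \sum_s c s * dcoef s t.
Proof.
rewrite /d sum_ffunE; apply: eq_bigr => s _.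
by rewrite ffunMzE -mulrzr mulrC -mulrzz mulrzz intz.
Qed.

(* The complex of the minor obtained by contracting P and deleting all other
   edges outside Q, in quantum degree j. *)
Definition minor P Q j : {set state} :=
  [set s | [&& P \subset sedges s, sedges s \subset P :|: Q & qdeg s == j]].

Notation Z := (exact_at (@hdeg T m E) dcoef).

(** As [d] preserves the quantum degree, the complex splits into the blocks [minor set0 E j]; the
    work is the passage between the quotient group and exactness of a block. *)
Lemma nonzero_degreeP i :
  nonzero_degree m E le i <-> exists j, ~ Z (minor set0 E j) i.
Proof.
have inm j s : (s \in minor set0 E j) = (qdeg s == j).
  by rewrite inE sub0set set0U sedges_sub.
have dminor j (c : state -> int) (b : chain m E) t :
    (forall s, qdeg s = j -> c s = b s) -> qdeg t = j ->
    (forall s, b s != 0 -> qdeg s = j) -> diff dcoef (minor set0 E j) c t = d le b t.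
  move=> cb tj bj; rewrite dE /diff big_mkcond /=; apply: eq_bigr => s _.
  rewrite inm; case: eqP => [/cb -> //|sj].
  by case: (eqVneq (b s) 0) => [->|/bj //]; rewrite mul0r.
have d0 (b : chain m E) j t : (forall s, b s != 0 -> qdeg s = j) -> qdeg t != j ->
    d le b t = 0.
  move=> bj tj; rewrite dE big1 // => s _; apply/eqP; rewrite mulf_eq0.
  apply/negPn/negP; rewrite negb_or => /andP[/bj sj /dcoef_neq0[/sle_qdeg st _]].
  by rewrite -st sj eqxx in tj.
split=> -[j].
  case=> h hn0; exists j => Zj; apply: hn0; rewrite -[h]reprK.
  pose z : Defs.cycle m E le i j := repr h; rewrite -/z.
  have zB : z \in @boundaries T m E le i j.
    rewrite inE; apply/asboolP; have := valP z.
    rewrite /= inE => /andP[/forallP zij /eqP dz].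
    pose zc : {ffun state -> int} := cycle_chain z.
    have zj s : zc s != 0 -> qdeg s = j.
      by move=> zs; have := zij s; rewrite [_ != _]zs => /andP[_ /eqP].
    have [||b [degb db]] := Zj (fun s => zc s).
    - move=> s _ hs; apply/eqP/negPn/negP => zs; have := zij s.
      by rewrite [X in X ==> _]zs (negbTE hs).
    - move=> t; rewrite inm => /eqP tj.
      by rewrite (dminor _ _ zc) // [d _ _]dz ffunE.
    (* Exactness of a block says nothing about values outside it, so these are cleared. *)
    pose b' : chain m E := [ffun s => if qdeg s == j then b s else 0].
    have b'j s : b' s != 0 -> qdeg s = j.
      by rewrite ffunE; case: (qdeg s =P j) => //; rewrite eqxx.
    exists b'; split.
      move=> s bs; split; last exact: b'j.
      move: bs; rewrite ffunE; case: ifP; rewrite ?eqxx // -inm => sm.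
      exact: degb.
    apply/ffunP => t; case: (eqVneq (qdeg t) j) => tj.
      rewrite -(dminor j b) //; first by rewrite db // inm tj.
      by move=> s sj; rewrite ffunE sj eqxx.
    rewrite (d0 _ _ _ b'j tj); apply/esym/eqP/negPn/negP => /zj h'.
    by rewrite h' eqxx in tj.
  apply/eqP; rewrite -(pi_zeror (s := [the zmodQuotType _ _ _ _ of homology m E le i j])).
  by rewrite -Quotient.idealrBE subr0.
move=> nZ; exists j; apply: contrapT => nh; apply: nZ => c degc dc.
pose c' : chain m E := [ffun s => if qdeg s == j then c s else 0].
have c'j s : c' s != 0 -> qdeg s = j.
  by rewrite ffunE; case: (qdeg s =P j) => //; rewrite eqxx.
have c'Z : c' \in cycles le i j.
  rewrite inE; apply/andP; split.
    apply/forallP => s; apply/implyP => cs; rewrite (c'j s cs) eqxx andbT.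
    apply/negPn/negP => hs; move: cs; rewrite ffunE; case: ifP; rewrite ?eqxx //.
    by rewrite -inm => sm; rewrite degc ?eqxx.
  apply/eqP/ffunP => t; rewrite ffunE; case: (eqVneq (qdeg t) j) => tj.
    rewrite -(dminor j c) //; first by rewrite dc // inm tj.
    by move=> s sj; rewrite ffunE sj eqxx.
  exact: d0 c'j tj.
pose z := Cycle c'Z.
have : z \in @boundaries T m E le i j.
  rewrite -[z]subr0 Quotient.idealrBE; apply/eqP; apply: contrapT => zn.
  apply: nh; exists (\pi_(homology m E le i j)%qT z) => z0; apply: zn; rewrite z0.
  by rewrite (pi_zeror (s := [the zmodQuotType _ _ _ _ of homology m E le i j])).
rewrite inE => /asboolP[b [degb db]]; exists b; split.
  by move=> s _ /degb[].
move=> t; rewrite inm => /eqP tj; rewrite (dminor j b b) // => [|s /degb[]//].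
by rewrite db /= ffunE tj eqxx.
Qed.

End States.

(** * Forests relative to contracted edges, and their leaves *)

Section Leaves.

Variable T : finType.
Implicit Types (F P Q : {set {set T}}) (e C D X : {set T}) (x y u v : T).

Lemma adj_saturated F X :
  (forall x y, adj F x y -> x \in X -> y \in X) -> saturated F X.
Proof.
move=> h x y /connectP[p pth ->]; elim: p x pth => //= z p IH x /andP[xz pth] xX.
exact: IH pth (h _ _ xz xX).
Qed.

Lemma cls_merge F u v x : ~~ connect (adj F) u v ->
  cls ([set u; v] |: F) x = if connect (adj F) x u || connect (adj F) x v
    then cls F u :|: cls F v else cls F x.
Proof.
move=> nuv; apply/setP => y; rewrite inE connectU1.
case: (boolP (connect (adj F) x u)) => [xu|xu] /=.
  rewrite !(same_connect (connectC F) xu) (negbTE nuv) !inE.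
  by rewrite orbF.
case: (boolP (connect (adj F) x v)) => [xv|xv]; rewrite ?orbF !inE //.
by rewrite (same_connect (connectC F) xv) orbC.
Qed.

Lemma eq_components_cls F F' x : components F = components F' -> cls F x = cls F' x.
Proof.
by move=> h; apply: component_cls (mem_cls F x); rewrite -h cls_component.
Qed.

(** [Q] is a forest once [P] is contracted, expressed by every edge of [Q] being a coloop. *)
Definition forest P Q := forall e, e \in Q -> kappa (P :|: Q) < kappa (P :|: (Q :\ e)).

Lemma disjointP P Q e : [disjoint P & Q] -> e \in Q -> e \notin P.
Proof. by move=> dis eQ; rewrite (disjointFl dis eQ). Qed.

Lemma setUD1K P Q e : e \in Q -> P :|: Q = e |: (P :|: (Q :\ e)).
Proof. by move=> eQ; rewrite setUCA setD1K. Qed.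

Lemma forest_edge P Q e : forest P Q -> e \in Q ->
  exists u v, e = [set u; v] /\ ~~ connect (adj (P :|: (Q :\ e))) u v.
Proof.
move=> fo eQ; have := fo e eQ; rewrite {1}(setUD1K P eQ).
case: (edge_cases e (P :|: (Q :\ e))) => [[-> _]|[u [v [-> h _]]]].
  by rewrite ltnn.
by move=> _; exists u, v.
Qed.

Lemma forest_nconnect P Q e u v : forest P Q -> e \in Q -> e = [set u; v] ->
  ~~ connect (adj (P :|: (Q :\ e))) u v.
Proof.
move=> fo eQ ee; apply/negP => uv; have := fo e eQ; rewrite {1}(setUD1K P eQ).
by rewrite /kappa {1}ee components_joined ?ltnn.
Qed.

(* A side of an edge of the forest with the fewest vertices is a leaf. *)
Lemma forest_leaf P Q : forest P Q -> Q != set0 ->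
  exists e u v, [/\ e \in Q, e = [set u; v], v \notin cls P u &
    forall F, P \subset F -> F \subset P :|: (Q :\ e) -> cls F u = cls P u].
Proof.
move=> fo /set0Pn[e0 e0Q].
pose ok (p : {set T} * T) := (p.1 \in Q) && (p.2 \in p.1).
pose sz (p : {set T} * T) := #|cls (P :|: (Q :\ p.1)) p.2|.
have [u0 [v0 [e0E _]]] := forest_edge fo e0Q.
have ok0 : ok (e0, u0) by rewrite /ok /= e0Q e0E !inE eqxx.
case: (arg_minnP sz ok0) => -[e u] /andP[/= eQ ue] min.
have [v [eE nuv]] : exists v, e = [set u; v] /\ ~~ connect (adj (P :|: (Q :\ e))) u v.
  have [a [b [eE nab]]] := forest_edge fo eQ.
  move: ue; rewrite {1}eE !inE => /orP[]/eqP ->; first by exists b.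
  by exists a; rewrite setUC connectC.
set F0 := P :|: (Q :\ e) in nuv *.
have sP : P \subset F0 by exact: subsetUl.
exists e, u, v; split=> //.
  by apply: contra nuv; rewrite inE; exact: connect_mono.
suff sat : saturated F0 (cls P u).
  move=> F PF FF; apply/eqP; rewrite eqEsubset; apply/andP; split.
    apply/subsetP => y; rewrite inE => /(connect_mono FF) /sat; apply.
    exact: mem_cls.
  by apply/subsetP => y; rewrite !inE; exact: connect_mono.
apply: adj_saturated => x y; rewrite {1}/adj /= !inE => xyF ux.
case/orP: xyF => [xyP|/andP[fe fQ]].
  by apply: connect_trans ux _; apply: connect1.
set f := [set x; y] in fe fQ; exfalso.
have nxy : ~~ connect (adj (P :|: (Q :\ f))) x y := forest_nconnect fo fQ erefl.
pose F1 := P :|: (Q :\ f :\ e).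
have sF10 : F1 \subset F0 by apply/setUS/setSD/subsetDl.
have sF1f : F1 \subset P :|: (Q :\ f) by apply/setUS/subsetDl.
have fF0 : f \in F0 by rewrite !inE fe fQ orbT.
have ux0 : connect (adj F0) u x by exact: connect_mono ux.
have uy0 : connect (adj F0) u y.
  by apply: connect_trans ux0 _; apply: connect1.
(* Removing [f] as well cuts one of its endpoints [a] off from [u]. The side of [a] at [f] lies
   inside the side of [u] at [e] and misses [u], against minimality. *)
have [a [af au0 nua]] : exists a, [/\ a \in f, connect (adj F0) u a
    & ~~ connect (adj F1) u a].
  case: (boolP (connect (adj F1) u x)) => h; last by exists x; rewrite !inE eqxx.
  exists y; split=> //; first by rewrite !inE eqxx orbT.
  apply: contra nxy => h'; apply: (connect_mono sF1f).
  by apply: connect_trans h'; rewrite connectC.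
have := min (f, a); rewrite /ok /= fQ af => /(_ isT); apply/negP; rewrite -ltnNge.
rewrite /sz /=; apply: proper_card; apply/properP; split.
  apply/subsetP => z; rewrite inE.
  have -> : P :|: (Q :\ f) = [set u; v] |: F1.
    by rewrite -eE -setUD1K // !inE eQ eq_sym fe.
  rewrite connectU1 (connectC F1 a u) (negbTE nua) /= inE.
  case/orP=> [az|/andP[av uz]]; last exact: connect_mono uz.
  by apply: connect_trans au0 _; apply: connect_mono az.
exists u; first exact: mem_cls.
rewrite inE.
have -> : P :|: (Q :\ f) = [set u; v] |: F1.
  by rewrite -eE -setUD1K // !inE eQ eq_sym fe.
rewrite connectU1 (connectC F1 a u) (negbTE nua) /= connect0 andbT.
apply: contra nuv => av; apply: connect_trans au0 _.
exact: connect_mono av.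
Qed.

Lemma forest_delete P Q e : [disjoint P & Q] -> forest P Q -> e \in Q ->
  forest P (Q :\ e).
Proof.
move=> dis fo eQ f /setD1P[fe fQ].
have [u [v [fE nuv]]] := forest_edge fo fQ.
rewrite (@setUD1K P (Q :\ e) f); last by rewrite !inE fe.
rewrite {1}fE -kappa_merge //; apply: contra nuv; apply: connect_mono.
by apply/setUS; apply/setSD/subsetDl.
Qed.

End Leaves.

(** * Deletion, contraction and the long exact sequence *)

Section Minors.

Variables (T : finType) (m : nat) (E : {set {set T}}) (le : rel {set T}).
Hypothesis le_total : total_order_on E le.

Notation state := (state m E).
Notation D := (@dcoef T m E le).
Notation Z := (exact_at (@hdeg T m E) D).
Notation minor := (@minor T m E).
Implicit Types (s t : state) (P Q F : {set {set T}}) (e : {set T}) (x u v : T).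

Lemma minor_convex P Q j : sle_convex (minor P Q j).
Proof.
move=> s t u; rewrite !inE => /and3P[Ps _ /eqP <-] /and3P[_ uPQ _] st tu.
have /sleP[sst _] := st; have /sleP[stu _] := tu.
by rewrite (subset_trans Ps) // (subset_trans stu) //= (sle_qdeg st).
Qed.

Lemma minor_complex P Q j : is_complex D (minor P Q j).
Proof. exact/dcoef_complex/minor_convex. Qed.

Lemma arrow_edge e s t : D s t != 0%R -> e \notin sedges s -> e \in sedges t ->
  sedges t = e |: sedges s.
Proof.
case/dcoef_neq0=> _ [f [_ tE]] /negbTE es; rewrite tE !inE es orbF => /eqP ->.
by [].
Qed.

Lemma minor_delete_mem P Q e j s : e \in Q -> e \notin P ->
  (s \in minor P (Q :\ e) j) = (s \in minor P Q j) && (e \notin sedges s).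
Proof.
move=> eQ eP; rewrite !inE; apply/idP/idP => [/and3P[-> h ->]|].
  rewrite (subset_trans h) ?setUS ?subsetDl //=.
  by apply/negP => /(subsetP h); rewrite !inE (negbTE eP) eqxx.
case/andP=> /and3P[-> h ->] es; rewrite andbT /=; apply/subsetP => f fs.
have := subsetP h f fs; rewrite !inE => /orP[->//|->].
by rewrite andbT (_ : f != e) ?orbT //; apply: contra es => /eqP <-.
Qed.

Lemma minor_contract_mem P Q e j s : e \in Q ->
  (s \in minor (e |: P) (Q :\ e) j) = (s \in minor P Q j) && (e \in sedges s).
Proof.
move=> eQ; rewrite !inE -setUA setUCA setD1K // subUset sub1set.
by case: (e \in sedges s); rewrite ?andbF ?andbT.
Qed.

Lemma minor_split P Q e j : e \in Q -> e \notin P ->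
  minor P Q j = minor P (Q :\ e) j :|: minor (e |: P) (Q :\ e) j.
Proof.
move=> eQ eP; apply/setP => s.
by rewrite in_setU minor_delete_mem // minor_contract_mem // -andb_orr orNb andbT.
Qed.

Lemma minor_disjoint P Q e j : e \in Q -> e \notin P ->
  [disjoint minor P (Q :\ e) j & minor (e |: P) (Q :\ e) j].
Proof.
move=> eQ eP; apply/pred0P => s /=.
rewrite minor_delete_mem // minor_contract_mem //.
by case: (e \in sedges s); rewrite ?andbF.
Qed.

Lemma minor_no_arrow P Q e j : e \in Q -> e \notin P ->
  no_arrow D (minor (e |: P) (Q :\ e) j) (minor P (Q :\ e) j).
Proof.
move=> eQ eP s t; rewrite minor_contract_mem // minor_delete_mem //.
case/andP=> _ es /andP[_ et]; apply/eqP/negPn/negP => /dcoef_neq0[/sleP[st _] _].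
by rewrite (subsetP st) in et.
Qed.

(** Since [d] only adds edges, the states containing [e] (the contraction) form a subcomplex and
    those avoiding it (the deletion) the quotient. No degree shift appears because the edges of [P]
    are counted. *)
Lemma exact_minor P Q e j i : e \in Q -> e \notin P ->
  Z (minor P (Q :\ e) j) i -> Z (minor (e |: P) (Q :\ e) j) i -> Z (minor P Q j) i.
Proof.
move=> eQ eP z1 z2; rewrite (minor_split _ eQ eP); apply: exact_at_ext => //.
- exact: (@dcoef_hdeg T m E le).
- exact: minor_disjoint.
- exact: minor_no_arrow.
- by rewrite -minor_split //; exact: minor_complex.
Qed.

Lemma exact_minor_delete P Q e j i : e \in Q -> e \notin P ->
  Z (minor P Q j) i -> Z (minor (e |: P) (Q :\ e) j) i.+1 -> Z (minor P (Q :\ e) j) i.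
Proof.
move=> eQ eP z1 z2; apply: (exact_at_quotient _ _ _ _ _ z2).
- exact: (@dcoef_hdeg T m E le).
- exact: minor_disjoint.
- exact: minor_no_arrow.
- by rewrite -minor_split //; exact: minor_complex.
- by rewrite -minor_split.
Qed.

Lemma exact_minor_contract P Q e j i : e \in Q -> e \notin P ->
  Z (minor P (Q :\ e) j) i.-1 -> Z (minor P Q j) i -> Z (minor (e |: P) (Q :\ e) j) i.
Proof.
move=> eQ eP z1 z2; apply: (exact_at_sub _ _ _ _ z1).
- exact: (@dcoef_hdeg T m E le).
- exact: minor_disjoint.
- exact: minor_no_arrow.
- by rewrite -minor_split //; exact: minor_complex.
- by rewrite -minor_split.
Qed.

(** Adding a loop changes neither components nor labels, so it matches the states of the deletion
    with those of the contraction by entries 1 or -1. *)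
Lemma exact_minor_loop P Q e j i : e \in Q -> e \notin P ->
  P :|: Q \subset E -> cycle_rank P [set e] = 0 -> Z (minor P Q j) i.
Proof.
move=> eQ eP PQE loop; have clsU F x : P \subset F -> cls (e |: F) x = cls F x.
  move=> PF; apply: eq_components_cls.
  case: (edge_cases e F) => [[_ ->]//|[u [v [_ _ kF]]]].
  have : kappa (e |: P) = kappa P.
    have := loop; rewrite /cycle_rank setUC => /eqP; rewrite subn_eq0 => h.
    by apply/eqP; rewrite eqn_leq h kappa_anti // subsetUr.
  by move/(kappaU1_sub PF) => h; rewrite h in kF; move: kF => /n_Sn.
have labE s t : P \subset sedges s -> sle s t -> sedges t = e |: sedges s ->
    labv t =1 labv s.
  by move=> Ps /sleP[_ h] tE x; rewrite h tE clsU // weight_cls.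
have inP s Q' j' : s \in minor P Q' j' -> P \subset sedges s.
  by rewrite inE => /and3P[].
rewrite (minor_split _ eQ eP); apply: exact_at_matching.
- exact: (@dcoef_hdeg T m E le).
- exact: minor_disjoint.
- by rewrite -minor_split //; exact: minor_complex.
- exact: dcoef_sqr.
- move=> t; rewrite minor_contract_mem // => /andP[tm et].
  have Pt : P \subset sedges t by exact: inP tm.
  have sD : sedges t :\ e \subset sedges t by exact: subsetDl.
  have PD : P \subset sedges t :\ e by rewrite subsetD1 Pt.
  have [|||s [sE ls]] := @state_ex T m E (sedges t :\ e) (labv t).
  + exact: subset_trans sD (sedges_sub t).
  + exact: labv_lt.
  + by move=> x y /(connect_mono sD); exact: labv_connect.
  have tE : sedges t = e |: sedges s by rewrite sE setD1K.
  have es : e \notin sedges s by rewrite sE !inE eqxx.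
  have st : sle s t.
    apply/sleP; rewrite sE; split=> // x.
    by rewrite tE clsU ?sE // -[in RHS]sE weight_cls ls.
  have Dst : D s t != 0%R by apply/dcoefP; split=> //; exists e.
  exists s; split=> //.
  + rewrite minor_delete_mem // es andbT inE sE PD (sle_qdeg st).
    by move: tm; rewrite inE => /and3P[_ h ->]; rewrite (subset_trans sD).
  + move=> s'; rewrite minor_delete_mem // => /andP[s'm es'] Ds't.
    have tE' := arrow_edge Ds't es' et; have [s't _] := dcoef_neq0 Ds't.
    apply: state_ext => [|x]; first by rewrite sE tE' setU1K.
    by rewrite ls (labE s' t) // (inP _ _ _ s'm).
  + move=> t'; rewrite minor_contract_mem // => /andP[_ et'] Dst'.
    have [st' _] := dcoef_neq0 Dst'.
    by apply: (sle_uniq st' st); rewrite (arrow_edge Dst' es et').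
- move=> s; rewrite minor_delete_mem // => /andP[sm es].
  have Ps : P \subset sedges s by exact: inP sm.
  have sPQ : e |: sedges s \subset P :|: Q.
    move: sm; rewrite inE => /and3P[_ h _].
    by rewrite subUset h sub1set inE eQ orbT.
  have [|||t [st tE]] := @sle_ex T m E s (e |: sedges s).
  + exact: subsetUr.
  + exact: subset_trans PQE.
  + by move=> x; rewrite clsU // weight_cls labv_lt.
  exists t; last by apply/dcoefP; split=> //; exists e.
  rewrite minor_contract_mem // tE setU11 andbT inE tE sPQ -(sle_qdeg st).
  move: sm; rewrite inE => /and3P[_ _ ->].
  by rewrite (subset_trans Ps) // subsetUr.
Qed.

End Minors.

Lemma weight_merge (T : finType) (m : nat) (E : {set {set T}}) (s : state m E) u v x :
  ~~ connect (adj (sedges s)) u v ->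
  weight s (cls ([set u; v] |: sedges s) x) =
    if connect (adj (sedges s)) x u || connect (adj (sedges s)) x v
    then labv s u + labv s v else labv s x.
Proof.
move=> nuv; rewrite cls_merge //; case: ifP => _; last exact: weight_cls.
rewrite /weight (eq_bigl (mem [set cls (sedges s) u; cls (sedges s) v])) /=.
  by rewrite big_setU1 ?inE ?cls_eqE //= big_set1 !lab_cls.
move=> C; rewrite !inE; apply/idP/idP.
  case/andP=> Cs /subsetP sC; have [y yC] := component_ex Cs.
  have := sC y yC; rewrite (component_cls Cs yC) !inE !cls_eqE.
  by rewrite !(connectC _ y).
by case/orP=> /eqP ->; rewrite cls_component ?subsetUl ?subsetUr.
Qed.

(** * Forests *)

Section Leaf.

Variables (T : finType) (m : nat) (E : {set {set T}}) (le : rel {set T}).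
Hypothesis le_total : total_order_on E le.
Variables (P Q : {set {set T}}) (e : {set T}) (u v : T).
Hypotheses (eQ : e \in Q) (eP : e \notin P) (PQE : P :|: Q \subset E).
Hypotheses (eE : e = [set u; v]) (nv : v \notin cls P u).
Hypothesis leaf : forall F : {set {set T}}, P \subset F -> F \subset P :|: (Q :\ e) ->
  cls F u = cls P u.

Notation state := (state m E).
Notation D := (@dcoef T m E le).
Notation Z := (exact_at (@hdeg T m E) D).
Notation minor := (@minor T m E).
Notation L := (cls P u).
Implicit Types (s t : state) (F : {set {set T}}) (x : T).

(** [R] is the deletion and [B] the contraction of [e]. Within [R] no edge leaves the leaf [L], so
    [d] preserves its label and [R] is a direct sum over that label: [W0] has 1, [W1] the multiples
    of x, [V] the labels that survive multiplication by x, and [top] has x^(m-1). *)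
Let R j := minor P (Q :\ e) j.
Let B j := minor (e |: P) (Q :\ e) j.
Let W0 j : {set state} := [set s in R j | labv s u == 0].
Let W1 j : {set state} := [set s in R j | 0 < labv s u].
Let V j : {set state} := [set s in R j | (labv s u).+1 < m].
Let top j : {set state} := [set s in R j | labv s u == m.-1].

Let deg_D := @dcoef_hdeg T m E le.

Let clsR j s : s \in R j -> cls (sedges s) u = L.
Proof. by rewrite inE => /and3P[Ps sPQ _]; exact: leaf. Qed.

Let inL j s x : s \in R j -> (x \in L) = connect (adj (sedges s)) u x.
Proof. by move=> /clsR <-; rewrite inE. Qed.

Let labL j s x : s \in R j -> x \in L -> labv s x = labv s u.
Proof. by move=> sR; rewrite (inL _ sR) => /labv_connect ->. Qed.

Let sle_label j j' s t : s \in R j -> t \in R j' -> sle s t -> labv t u = labv s u.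
Proof.
by move=> sR tR /sleP[_ ->]; rewrite (clsR tR) -(clsR sR) weight_cls.
Qed.

Let no_arrow_label j (X Y : {set state}) (p : pred nat) :
  X \subset R j -> Y \subset R j -> (forall s, s \in X -> p (labv s u)) ->
  (forall s, s \in Y -> ~~ p (labv s u)) -> no_arrow D X Y /\ no_arrow D Y X.
Proof.
move=> /subsetP XR /subsetP YR Xp Yp.
split=> s t sX tY; apply/eqP/negPn/negP => /dcoef_neq0[st _].
- by have := Yp t tY; rewrite (sle_label (XR _ sX) (YR _ tY) st) Xp.
- by have := Yp s sX; rewrite -(sle_label (YR _ sX) (XR _ tY) st) Xp.
Qed.

Let sub_label j (p : pred state) : [set s in R j | p s] \subset R j.
Proof. by apply/subsetP => s; rewrite inE => /andP[]. Qed.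

Let R_W j : R j = W1 j :|: W0 j.
Proof.
by apply/setP => s; rewrite !inE -andb_orr lt0n orNb andbT.
Qed.

Let exact_W1_of_R j i : Z (R j) i -> Z (W1 j) i.
Proof.
rewrite R_W; have [] := @no_arrow_label j (W1 j) (W0 j) (fun k => 0 < k).
- exact: sub_label.
- exact: sub_label.
- by move=> s; rewrite inE => /andP[].
- by move=> s; rewrite inE => /andP[_ /eqP ->].
move=> n1 n2; apply: exact_at_summand => //.
apply/pred0P => s /=; rewrite !inE lt0n; case: (labv s u == 0); rewrite ?andbF //.
Qed.

Let R_V j : 0 < m -> R j = V j :|: top j.
Proof.
move=> m0; apply/setP => s; rewrite !inE -andb_orr; have := labv_lt s u.
case: (boolP (_ || _)) => h lt; rewrite ?andbT //; move: h lt.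
by move: (labv s u) => k; rewrite negb_or; lia.
Qed.

Let V_top j : 0 < m -> [disjoint V j & top j].
Proof.
move=> m0; apply/pred0P => s /=; rewrite !inE; case: (boolP (_ == m.-1)) => h.
  by move: h m0; move: (labv s u) => k h m0; rewrite [_ < m](_ : _ = false) ?andbF //; lia.
by rewrite !andbF.
Qed.

Let V_top_no_arrow j : 0 < m -> no_arrow D (V j) (top j) /\ no_arrow D (top j) (V j).
Proof.
move=> m0; apply: (@no_arrow_label j _ _ (fun k => k.+1 < m)).
- exact: sub_label.
- exact: sub_label.
- by move=> s; rewrite inE => /andP[].
- move=> s; rewrite inE => /andP[_ /eqP ->]; lia.
Qed.

Let exact_V_of_R j i : 0 < m -> Z (R j) i -> Z (V j) i.
Proof.
move=> m0; rewrite R_V //; have [n1 n2] := V_top_no_arrow j m0.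
by apply: exact_at_summand => //; exact: V_top.
Qed.

(** Here 1 < m makes x^(m-1) a multiple of x, so that [top] is a summand of [W1]. *)
Let exact_top_of_W1 j i : 1 < m -> Z (W1 j) i -> Z (top j) i.
Proof.
move=> m1; pose X : {set state} := [set s in R j | (0 < labv s u) && (labv s u != m.-1)].
have -> : W1 j = top j :|: X.
  apply/setP => s; rewrite !inE -andb_orr; congr andb.
  by move: m1; move: (labv s u) => k m1; lia.
have [] := @no_arrow_label j (top j) X (fun k => k == m.-1).
- exact: sub_label.
- exact: sub_label.
- by move=> s; rewrite inE => /andP[].
- by move=> s; rewrite inE => /and3P[].
move=> n1 n2; apply: exact_at_summand => //.
by apply/pred0P => s /=; rewrite !inE; case: (_ == m.-1); rewrite ?andbF.
Qed.

(** [s] is [s'] with the label of the leaf multiplied by x. *)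
Definition shift s s' := [/\ sedges s = sedges s',
  forall x, x \notin L -> labv s x = labv s' x
  & forall x, x \in L -> labv s x = (labv s' x).+1].

Let shift_injl s1 s2 s : shift s1 s -> shift s2 s -> s1 = s2.
Proof.
move=> [e1 o1 i1] [e2 o2 i2]; apply: state_ext => [|x]; first by rewrite e1.
by case: (boolP (x \in L)) => h; [rewrite i1 // i2 | rewrite o1 // o2].
Qed.

Let shift_injr s s1 s2 : shift s s1 -> shift s s2 -> s1 = s2.
Proof.
move=> [e1 o1 i1] [e2 o2 i2]; apply: state_ext => [|x]; first by rewrite -e1.
case: (boolP (x \in L)) => h; last by rewrite -o1 // -o2.
by apply: succn_inj; rewrite -i1 // -i2.
Qed.

Let shift_weight s s' (X : {set T}) : shift s s' -> X :&: L = set0 ->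
  weight s X = weight s' X.
Proof.
move=> [sE o _] XL; rewrite /weight sE; apply: eq_bigr => C /andP[Cs /subsetP CX].
have [x xC] := component_ex Cs.
rewrite (lab_component Cs xC) (lab_component _ xC) ?sE // o //.
by apply/negP => xL; move/setP: XL => /(_ x); rewrite !inE (CX x xC) -[connect _ _ _]inE xL.
Qed.

Let shift_qdeg j s s' : s \in R j -> shift s s' -> qdeg s = (qdeg s').+1.
Proof.
move=> sR [sE o i]; rewrite !qdeg_weight /weight sE.
have LC : L \in components (sedges s') by rewrite -sE -(clsR sR) cls_component.
have uL : u \in L by exact: mem_cls.
rewrite (bigD1 L) ?LC ?subsetT //= [in RHS](bigD1 L) ?LC ?subsetT //=.
rewrite (lab_component _ uL) ?sE // (lab_component LC uL) i // addSn.
congr (_ + _).+1; apply: eq_bigr => C /andP[/andP[Cs _] CL].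
have [x xC] := component_ex Cs.
rewrite (lab_component Cs xC) (lab_component _ xC) ?sE // o //.
apply: contra CL => xL.
by rewrite (component_cls Cs xC) (component_cls LC xL).
Qed.

Let shift_sle_imp j s t s' t' : s \in R j -> t \in R j -> shift s s' -> shift t t' ->
  sle s t = sle s' t'.
Proof.
move=> sR tR ss tt; have [sE so si] := ss; have [tE to ti] := tt.
rewrite /sle sE -tE; congr andb; apply: eq_forallb => x.
case: (boolP (x \in L)) => xL.
  have -> : cls (sedges t) x = L.
    by rewrite -(clsR tR); apply: cls_eq; rewrite (clsR tR).
  have clx : L = cls (sedges s) x.
    by rewrite -(clsR sR); apply/esym/cls_eq; rewrite (clsR sR).
  rewrite {1}clx weight_cls clx sE weight_cls ti // si //.
rewrite to // (shift_weight ss) //; apply/setP => y; rewrite in_setI in_set0.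
apply/negP => /andP[]; rewrite (inL _ tR) inE => xy uy; case/negP: xL.
by rewrite (inL _ tR) connectC; apply: connect_trans xy _; rewrite connectC.
Qed.

Let shift_dcoef j s t s' t' : s \in R j -> t \in R j -> shift s s' -> shift t t' ->
  D s' t' = D s t.
Proof.
move=> sR tR ss tt; have [sE _ _] := ss; have [tE _ _] := tt.
have slE := shift_sle_imp sR tR ss tt.
have [z|/eqP] := eqVneq (D s t) 0%R.
  rewrite z; apply/eqP/negPn/negP => /dcoefP[].
  rewrite -slE -sE -tE => st h; move/eqP: z; apply/negP; exact/dcoefP.
move/eqP/dcoefP=> [st [f [fs tf]]]; rewrite (dcoef_cover le fs tf st).
rewrite slE in st; rewrite sE in fs tf; rewrite tE in tf.
by rewrite (dcoef_cover le fs tf st) /sgn /edges_before sE.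
Qed.

Let shift_R j s s' : shift s s' -> (s \in R j.+1) = (s' \in R j).
Proof.
move=> ss; have [sE _ _] := ss.
apply/idP/idP => [sR|].
  by have := sR; rewrite !inE sE (shift_qdeg sR ss) eqSS.
rewrite !inE -sE => /and3P[h1 h2 /eqP <-].
have sR : s \in R (qdeg s) by rewrite inE h1 h2 eqxx.
by rewrite h1 h2 (shift_qdeg sR ss) eqxx.
Qed.

Let shift_down j s : s \in W1 j.+1 -> exists s', shift s s' /\ s' \in V j.
Proof.
rewrite inE => /andP[sR lu].
have [|||s' [sE ls]] := @state_ex T m E (sedges s)
    (fun x => if x \in L then (labv s x).-1 else labv s x).
- exact: sedges_sub.
- move=> x; case: ifP => _; last exact: labv_lt.
  exact: leq_ltn_trans (leq_pred _) (labv_lt s x).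
- move=> x y xy; rewrite !(inL _ sR) (labv_connect xy).
  by rewrite ![connect _ u _]connectC (same_connect (@connectC T (sedges s)) xy).
have ss : shift s s'.
  split=> // x xL; rewrite ls ?(negbTE xL) // xL prednK //.
  by rewrite (labL sR xL).
exists s'; split=> //; rewrite inE -(shift_R _ ss) sR /=.
have [_ _ i] := ss; rewrite -i ?labv_lt //; exact: mem_cls.
Qed.

Let shift_up j s' : s' \in V j -> exists s, shift s s' /\ s \in W1 j.+1.
Proof.
rewrite inE => /andP[sR lu].
have [|||s [sE ls]] := @state_ex T m E (sedges s')
    (fun x => if x \in L then (labv s' x).+1 else labv s' x).
- exact: sedges_sub.
- move=> x; case: ifP => [xL|_]; last exact: labv_lt.
  by rewrite (labL sR xL).
- move=> x y xy; rewrite !(inL _ sR) (labv_connect xy).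
  by rewrite ![connect _ u _]connectC (same_connect (@connectC T (sedges s')) xy).
have ss : shift s s'.
  by split=> // x xL; rewrite ls ?(negbTE xL) // xL.
exists s; split=> //; rewrite inE (shift_R _ ss) sR /=.
have [_ _ i] := ss; rewrite i //; exact: mem_cls.
Qed.

(** Multiplying the leaf's label by x commutes with [d], maps [V] bijectively onto [W1] and raises
    the quantum degree by one. *)
Let exact_V_W1 j i : Z (V j) i <-> Z (W1 j.+1) i.
Proof.
have [f fP] : {f : state -> state & forall s, s \in W1 j.+1 -> shift s (f s) /\ f s \in V j}.
  apply: (@choice _ _ (fun s s' => s \in W1 j.+1 -> shift s s' /\ s' \in V j)) => s.
  case: (boolP (s \in W1 j.+1)) => [/shift_down[s' h]|_]; first by exists s'.
  by exists s.
have [g gP] : {g : state -> state & forall s, s \in V j -> shift (g s) s /\ g s \in W1 j.+1}.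
  apply: (@choice _ _ (fun s s' => s \in V j -> shift s' s /\ s' \in W1 j.+1)) => s.
  case: (boolP (s \in V j)) => [/shift_up[s' h]|_]; first by exists s'.
  by exists s.
have inR1 s : s \in W1 j.+1 -> s \in R j.+1 by rewrite inE => /andP[].
have fK : {in W1 j.+1, cancel f g}.
  by move=> s sW; have [h1 h2] := fP s sW; have [h3 _] := gP _ h2; exact: shift_injl h3 h1.
have gK : {in V j, cancel g f}.
  by move=> s sW; have [h1 h2] := gP s sW; have [h3 _] := fP _ h2; exact: shift_injr h3 h1.
split; [apply: (exact_at_iso (f := g) (g := f)) => //
       | apply: (exact_at_iso (f := f) (g := g)) => //].
- by move=> s /gP[].
- by move=> s /fP[].
- by move=> s /gP[[h _ _] _]; rewrite /hdeg h.
- move=> s t /gP[ss sW] /gP[tt tW].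
  by rewrite -(shift_dcoef (inR1 _ sW) (inR1 _ tW) ss tt).
- by move=> s /fP[].
- by move=> s /gP[].
- by move=> s /fP[[h _ _] _]; rewrite /hdeg h.
- move=> s t sW tW; have [ss _] := fP s sW; have [tt _] := fP t tW.
  by rewrite (shift_dcoef (inR1 _ sW) (inR1 _ tW) ss tt).
Qed.

Let exact_W1_0 i : Z (W1 0) i.
Proof.
suff -> : W1 0 = set0 by exact: exact_at_set0.
apply/setP => s; rewrite in_set0; apply/negP; rewrite inE => /andP[sR].
move: sR; rewrite inE => /and3P[_ _]; rewrite qdeg_weight => /eqP w0.
by have := weight_mono s (subsetT (cls (sedges s) u)); rewrite weight_cls w0; lia.
Qed.

Let nuv s j : s \in R j -> ~~ connect (adj (sedges s)) u v.
Proof. by move=> sR; rewrite -(inL _ sR). Qed.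

Let B_del j t : t \in B j -> exists F, [/\ F = sedges t :\ e, sedges t = e |: F,
  e \notin F, P \subset F & F \subset P :|: (Q :\ e)].
Proof.
rewrite minor_contract_mem // inE => /andP[/and3P[Pt tPQ _] et].
exists (sedges t :\ e); split; rewrite ?setD1K // ?inE ?eqxx ?subsetD1 ?Pt //.
apply/subsetP => f /setD1P[fe /(subsetP tPQ)]; by rewrite !inE fe.
Qed.

(* In a state of W0 the leaf carries the unit label, so that adding e to it
   only relabels vertices of the leaf. *)
Let W0_label j s t : s \in W0 j -> sle s t -> sedges t = e |: sedges s ->
  forall x, labv s x = if x \in L then 0 else labv t x.
Proof.
rewrite inE => /andP[sR /eqP s0] /sleP[_ lt] tE x; case: ifP => xL.
  by rewrite (labL sR xL).
rewrite lt tE eE weight_merge ?(nuv sR) // s0 add0n.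
rewrite connectC -(inL _ sR) xL /=; case: ifP => // /labv_connect //.
Qed.

(** Merging a leaf labelled 1 along [e] multiplies by 1, so it never vanishes and is undone by
    restoring the label 1: a perfect matching of [W0] with [B]. *)
Let exact_W0B j i : Z (W0 j :|: B j) i.
Proof.
apply: exact_at_matching.
- exact: deg_D.
- apply: (@disjointWl _ _ (R j)); last exact: minor_disjoint.
  exact: sub_label.
- apply: dcoef_complex => // s t w; rewrite !in_setU => sU wU st tw.
  have st' := sleP _ _ st; have tw' := sleP _ _ tw.
  have WB a : a \in W0 j :|: B j -> a \in minor P Q j.
    rewrite (minor_split _ _ _ eQ eP) !inE => /orP[/andP[->]|->] //; by rewrite orbT.
  have tm : t \in minor P Q j.
    by apply: (@minor_convex T m E P Q j s t w) => //; apply: WB; rewrite in_setU.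
  move: (tm); rewrite (minor_split _ _ _ eQ eP) in_setU => /orP[tR|->]; last by rewrite orbT.
  rewrite inE tR /=; case/orP: sU => [|sB]; last first.
    move: sB tR; rewrite minor_contract_mem // => /andP[_ es].
    rewrite [_ \in R j]minor_delete_mem // => /andP[_ /negP[]].
    by case: st' => h _; exact: (subsetP h).
  by rewrite inE => /andP[sR /eqP s0]; rewrite (sle_label sR tR st) s0.
- exact: dcoef_sqr.
- move=> t tB; have [F [FE tE eF PF FPQ]] := B_del tB.
  have LF x : (x \in L) = connect (adj F) u x by rewrite -(leaf PF FPQ) inE.
  have Ft : F \subset sedges t by rewrite FE subsetDl.
  (* The partner of [t]: drop [e], put 1 on the leaf, and leave the product label of the merged
     component to the other end. *)
  have [|||s [sE ls]] := @state_ex T m E F (fun x => if x \in L then 0 else labv t x).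
  + exact: subset_trans Ft (sedges_sub t).
  + move=> x; case: ifP => _; last exact: labv_lt.
    exact: leq_ltn_trans (leq0n _) (labv_lt t x).
  + move=> x y xy; rewrite !LF (labv_connect (connect_mono Ft xy)).
    by rewrite ![connect _ u _]connectC (same_connect (@connectC T F) xy).
  have uL : u \in L := mem_cls P u.
  have tE' : sedges t = e |: sedges s by rewrite sE.
  have nuvF : ~~ connect (adj (sedges s)) u v by rewrite sE -LF.
  have st : sle s t.
    apply/sleP; rewrite sE; split=> // x; rewrite tE' eE weight_merge // sE.
    rewrite !ls uL (negbTE nv) add0n LF (connectC F u x).
    have uvt : connect (adj (sedges t)) u v by apply: connect1; rewrite /adj /= -eE tE setU11.
    case: (boolP (connect (adj F) x u)) => [/(connect_mono Ft) xu|_] /=.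
      by apply: labv_connect; exact: connect_trans xu uvt.
    case: ifP => [/(connect_mono Ft) xv|_ //]; exact: labv_connect.
  have es : e \notin sedges s by rewrite sE.
  have et : e \in sedges t by rewrite tE setU11.
  have sW : s \in W0 j.
    rewrite inE ls uL eqxx andbT [_ \in R j]minor_delete_mem // es andbT.
    move: tB; rewrite minor_contract_mem // !inE (sle_qdeg st) sE PF.
    case/andP=> /and3P[_ _ ->] _; rewrite (subset_trans FPQ) //.
    by apply/setUS/subsetDl.
  exists s; split=> //.
  + by apply/dcoefP; split=> //; exists e.
  + move=> s' s'W Ds't; have [s't _] := dcoef_neq0 Ds't.
    have es' : e \notin sedges s'.
      by move: s'W; rewrite inE => /andP[]; rewrite [_ \in R j]minor_delete_mem // => /andP[].
    have tE2 := arrow_edge Ds't es' et.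
    apply: state_ext => [|x]; first by rewrite sE FE tE2 setU1K.
    by rewrite ls (W0_label s'W s't tE2).
  + move=> t' t'B Dst'; have [st' _] := dcoef_neq0 Dst'.
    apply: (sle_uniq st' st); rewrite tE' (arrow_edge Dst' es) //.
    by move: t'B; rewrite minor_contract_mem // => /andP[].
- move=> s sW; have := sW; rewrite inE => /andP[sR /eqP s0].
  move: (sR); rewrite [_ \in R j]minor_delete_mem // => /andP[sm es].
  have sPQ : e |: sedges s \subset P :|: Q.
    by move: sm; rewrite inE => /and3P[_ h _]; rewrite subUset h sub1set inE eQ orbT.
  have [|||t [st tE]] := @sle_ex T m E s (e |: sedges s).
  + exact: subsetUr.
  + exact: subset_trans PQE.
  + move=> x; rewrite eE weight_merge ?(nuv sR) // s0 add0n.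
    by case: ifP => _; exact: labv_lt.
  exists t; last by apply/dcoefP; split=> //; exists e.
  rewrite minor_contract_mem // tE setU11 andbT inE tE sPQ -(sle_qdeg st).
  move: sm; rewrite inE => /and3P[Ps _ ->].
  by rewrite (subset_trans Ps) // subsetUr.
Qed.

(** [W0] and [B] together form an acyclic subcomplex, so the minor has the cohomology of the
    quotient [W1]. *)
Let minorE j : minor P Q j = W1 j :|: (W0 j :|: B j).
Proof. by rewrite (minor_split _ _ _ eQ eP) setUA -R_W. Qed.

Let W1_disjoint j : [disjoint W1 j & W0 j :|: B j].
Proof.
apply/pred0P => s /=; rewrite in_setU [s \in W1 j]inE [s \in W0 j]inE.
apply/negP => /andP[/andP[sR l0] /orP[/andP[_ /eqP h]|sB]].
  by rewrite h in l0.
by have := pred0P (minor_disjoint m E j eQ eP) s; rewrite /= sR sB.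
Qed.

Let W1_no_arrow j : no_arrow D (W0 j :|: B j) (W1 j).
Proof.
move=> s t; rewrite in_setU => /orP[sW|sB] tW.
  have [] := @no_arrow_label j (W1 j) (W0 j) (fun k => 0 < k).
  - exact: sub_label.
  - exact: sub_label.
  - by move=> s'; rewrite inE => /andP[].
  - by move=> s'; rewrite inE => /andP[_ /eqP ->].
  by move=> _ h; exact: h.
apply: (minor_no_arrow le eQ eP sB); by move: tW; rewrite inE => /andP[].
Qed.

Let complexE j : is_complex D (W1 j :|: (W0 j :|: B j)).
Proof. by rewrite -minorE; exact: minor_complex. Qed.

Let exact_of_W1 j i : Z (W1 j) i -> Z (minor P Q j) i.
Proof.
move=> zW; rewrite minorE; apply: exact_at_ext => //; exact: W1_no_arrow.
Qed.

Lemma exact_leaf j i : Z (minor P (Q :\ e) j) i -> Z (minor P Q j) i.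
Proof. by move=> z; apply: exact_of_W1; exact: exact_W1_of_R. Qed.

Lemma exact_leafS j i : 0 < m -> Z (minor P (Q :\ e) j) i -> Z (minor P Q j.+1) i.
Proof.
by move=> m0 z; apply: exact_of_W1; apply/exact_V_W1; exact: exact_V_of_R.
Qed.

Lemma exact_leaf0 i : Z (minor P Q 0) i.
Proof. exact: exact_of_W1. Qed.

(** [R] is the sum of [V] and [top]. The minor in quantum degree j + 1 controls [V] in degree j;
    [top] in degree j is a summand of [W1], a shifted copy of [V] in degree j - 1, which the
    vanishing below j kills. *)
Lemma exact_of_leaf j i : 1 < m ->
  (forall k, k < j -> Z (minor P (Q :\ e) k) i) ->
  Z (minor P Q j.+1) i -> Z (minor P (Q :\ e) j) i.
Proof.
move=> m1 lo; rewrite minorE => z; have m0 : 0 < m by lia.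
have zV : Z (V j) i.
  by apply/exact_V_W1; apply: (exact_at_quotient deg_D _ _ _ z).
have ztop : Z (top j) i.
  apply: exact_top_of_W1 => //; case: j lo {z zV} => [|k] lo; first exact: exact_W1_0.
  by apply/exact_V_W1; apply: exact_V_of_R => //; exact: lo.
rewrite -/(R j) R_V //; apply: exact_at_ext => //.
- exact: V_top.
- by have [] := V_top_no_arrow j m0.
- by rewrite -R_V //; exact: minor_complex.
Qed.

End Leaf.

Section Forest.

Variables (T : finType) (m : nat) (E : {set {set T}}) (le : rel {set T}).
Hypothesis le_total : total_order_on E le.
Hypothesis m_gt1 : 1 < m.
Notation D := (@dcoef T m E le).
Notation Z := (exact_at (@hdeg T m E) D).
Notation minor := (@minor T m E).

(** Each leaf removed lowers the quantum degree by one and keeps the homological one. Without edges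
    the complex sits in degree [#|P|] with zero differential, and the state labelled 1 everywhere
    gives quantum degree 0. *)
Lemma exact_forest (P Q : {set {set T}}) :
  [disjoint P & Q] -> P :|: Q \subset E -> forest P Q ->
  [/\ forall i j, #|P| < i -> Z (minor P Q j) i,
      forall i j, j < #|Q| -> Z (minor P Q j) i
    & ~ Z (minor P Q #|Q|) #|P|].
Proof.
have [n] := ubnP #|Q|; elim: n Q => // n IH Q le_n dis PQE fo.
have m0 : 0 < m by lia.
case: (eqVneq Q set0) => [Q0|Qn0].
  subst Q; rewrite cards0; split=> // [i j lt|z].
    move=> c degc _; exists (fun=> 0%R); split=> [s _|t tm]; first by rewrite eqxx.
    rewrite /diff big1 => [|s _]; last by rewrite mul0r.
    rewrite degc //; move: tm; rewrite inE setU0 => /and3P[h1 h2 _].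
    have -> : hdeg t = #|P| by rewrite /hdeg; apply/eqP; rewrite eqn_leq !subset_leq_card.
    by rewrite neq_ltn lt.
  have [|||s [sE ls]] := @state_ex T m E P (fun=> 0) => //.
    by move: PQE; rewrite setU0.
  have sm : s \in minor P set0 0.
    rewrite inE sE setU0 !subxx qdeg_weight /weight big1 // => C /andP[Cs _].
    by have [x xC] := component_ex Cs; rewrite (lab_component Cs xC) ls.
  have hP t : t \in minor P set0 0 -> hdeg t = #|P|.
    rewrite inE setU0 => /and3P[h1 h2 _].
    by rewrite /hdeg; apply/eqP; rewrite eqn_leq !subset_leq_card.
  have [||b [degb db]] := z (fun=> 1%R).
  - by move=> t /hP ->; rewrite eqxx.
  - move=> t tm; rewrite /diff big1 // => t' t'm; rewrite mul1r.
    apply/eqP/negPn/negP => /dcoef_hdeg; rewrite (hP t tm) (hP t' t'm); lia.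
  have := db s sm; rewrite /diff big1 // => t tm.
  have [->|/(degb t tm)] := eqVneq (b t) 0%R; first by rewrite mul0r.
  by rewrite (hP t tm); lia.
have [e [u [v [eQ eE nv leaf]]]] := forest_leaf fo Qn0.
have eP := disjointP dis eQ.
have sQ : Q :\ e \subset Q by exact: subsetDl.
have cQ : #|Q| = #|Q :\ e|.+1 by rewrite (cardsD1 e) eQ.
have [||||a b c] := IH (Q :\ e).
- by rewrite -ltnS -cQ.
- exact: disjointWr sQ dis.
- exact: subset_trans (setUS P sQ) PQE.
- exact: forest_delete.
split.
- move=> i j lt; exact: (exact_leaf le_total eQ eP PQE eE nv leaf (a i j lt)).
- move=> i [|j] lt; first exact: (exact_leaf0 le_total eQ eP PQE eE nv leaf).
  apply: (exact_leafS le_total eQ eP PQE eE nv leaf m0); apply: b.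
  by rewrite -ltnS -cQ.
- rewrite cQ => z; apply: c; apply: (exact_of_leaf le_total eQ eP PQE eE nv leaf m_gt1) z.
  by move=> k; exact: b.
Qed.

End Forest.

(** * Deletion and contraction *)

Section DeletionContraction.

Variables (T : finType) (m : nat) (E : {set {set T}}) (le : rel {set T}).
Hypothesis le_total : total_order_on E le.
Hypothesis m_gt1 : 1 < m.
Notation Z := (exact_at (@hdeg T m E) (@dcoef T m E le)).
Notation minor := (@minor T m E).
Implicit Types (P Q : {set {set T}}) (e : {set T}).

Lemma coloops_forest P Q :
  (forall e, e \in Q -> cycle_rank P (Q :\ e) < cycle_rank P Q) -> forest P Q.
Proof.
move=> h e /h; rewrite /cycle_rank; have := kappa_anti (subsetUl P (Q :\ e)).
by move: (kappa P) (kappa (P :|: Q)) (kappa _) => *; lia.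
Qed.

Lemma loop_coloop_cases P Q :
  [\/ exists2 e, e \in Q & cycle_rank P [set e] = 0,
      (forall e, e \in Q -> cycle_rank P [set e] = 1) /\
      (exists2 e, e \in Q & cycle_rank P (Q :\ e) = cycle_rank P Q)
    | (forall e, e \in Q -> cycle_rank P [set e] = 1) /\
      (forall e, e \in Q -> cycle_rank P (Q :\ e) < cycle_rank P Q)].
Proof.
have [/exists_inP[e eQ /eqP e0]|/exists_inPn h] :=
  boolP [exists e in Q, cycle_rank P [set e] == 0].
  by apply: Or31; exists e.
have nl e : e \in Q -> cycle_rank P [set e] = 1.
  by move=> /h; have := rank1_le (cycle_rank_axioms P) e; case: (cycle_rank _ _) => [|[]].
have [/exists_inP[e eQ /eqP e0]|/exists_inPn h'] :=
  boolP [exists e in Q, cycle_rank P (Q :\ e) == cycle_rank P Q].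
  by apply: Or32; split=> //; exists e.
apply: Or33; split=> // e /h'; rewrite ltn_neqAle => ->.
by rewrite (rank_mono (cycle_rank_axioms P)) // subsetDl.
Qed.

Section Step.

Variables (P Q : {set {set T}}) (e : {set T}).
Hypotheses (dis : [disjoint P & Q]) (eQ : e \in Q) (PQE : P :|: Q \subset E).

Lemma card_delete : #|Q| = #|Q :\ e|.+1.
Proof. by rewrite (cardsD1 e) eQ. Qed.

Lemma delete_disjoint : [disjoint P & Q :\ e].
Proof. exact: disjointWr (subsetDl _ _) dis. Qed.

Lemma contract_disjoint : [disjoint e |: P & Q :\ e].
Proof.
rewrite disjoint_subset; apply/subsetP => f; rewrite !inE.
case/orP=> [/eqP ->|fP]; first by rewrite eqxx.
by rewrite (disjointFr dis fP) andbF.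
Qed.

Lemma delete_sub : P :|: (Q :\ e) \subset E.
Proof. exact: subset_trans (setUS P (subsetDl _ _)) PQE. Qed.

Lemma contract_sub : (e |: P) :|: (Q :\ e) \subset E.
Proof. by rewrite -setUA setUCA setD1K. Qed.

Lemma contract_card : #|e |: P| = #|P|.+1.
Proof. by rewrite cardsU1 (disjointP dis eQ). Qed.

Lemma contract_cycle_rank : cycle_rank P [set e] = 1 ->
  (cycle_rank (e |: P) (Q :\ e)).+1 = cycle_rank P Q.
Proof.
move=> e1; rewrite -cycle_rank_contract /contract e1 setD1K // subn1 prednK //.
by rewrite -e1; apply: (rank_mono (cycle_rank_axioms P)); rewrite sub1set.
Qed.

End Step.

(** Both bounds are inherited by the deletion and the contraction of a noncoloop, since
    [#|P| + cycle_rank P Q] and b are unchanged. If only coloops remain, [Q] is a forest, and b is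
    at most its number of edges. The additive form avoids truncated subtraction. *)
Lemma exact_splitting P Q b col : [disjoint P & Q] -> P :|: Q \subset E ->
  splitting (cycle_rank P) Q b col ->
  (forall i j, #|P| + cycle_rank P Q < i + b -> Z (minor P Q j) i) /\
  (forall i j, j < b -> Z (minor P Q j) i).
Proof.
have [n] := ubnP #|Q|; elim: n P Q => // n IH P Q le_n dis PQE spl.
have rax := cycle_rank_axioms P.
case: (loop_coloop_cases P Q) => [[e eQ e0]|[nl [e eQ nco]]|[nl co]].
- by split=> *; exact: (exact_minor_loop le_total eQ (disjointP dis eQ) PQE e0).
- have eP := disjointP dis eQ.
  have lt_n : #|Q :\ e| < n by rewrite -ltnS -(card_delete eQ).
  have [d1 d2] := IH _ _ lt_n (delete_disjoint e dis) (delete_sub e PQE)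
    (splitting_delete rax spl eQ nco nl).
  have splc := splitting_contract rax spl eQ nco nl.
  rewrite cycle_rank_contract in splc.
  have [c1 c2] := IH _ _ lt_n (contract_disjoint e dis) (contract_sub eQ PQE) splc.
  split=> i j h; apply: (exact_minor le_total eQ eP).
  + by apply: d1; rewrite nco.
  + apply: c1; rewrite (contract_card dis eQ) addSn -addnS.
    by rewrite (contract_cycle_rank eQ (nl e eQ)).
  + exact: d2.
  + exact: c2.
- have fo := coloops_forest co; have rQ := rank_all_coloops rax co.
  have bQ := splitting_le_rank rax spl nl.
  have [a1 a2 _] := exact_forest le_total m_gt1 dis PQE fo.
  split=> i j h; [apply: a1|apply: a2].
    by move: bQ h; move: (cycle_rank P Q) => r; lia.
  by rewrite -rQ; exact: leq_trans bQ.
Qed.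

(** A single loop is connected in the sense of [matroid_connected] although it makes the complex
    acyclic, hence the separate exclusion of loops. *)
Lemma nonexact_splitting P Q b col i : [disjoint P & Q] -> P :|: Q \subset E ->
  splitting (cycle_rank P) Q b col ->
  (forall e, e \in Q -> cycle_rank P [set e] = 1) ->
  (forall c, c < b -> matroid_connected (cycle_rank P) (color_class Q col c)) ->
  i + b = #|P| + cycle_rank P Q -> ~ Z (minor P Q b) i.
Proof.
have [n] := ubnP #|Q|; elim: n P Q => // n IH P Q le_n dis PQE spl nl conn ib.
have rax := cycle_rank_axioms P; set r := cycle_rank P in rax spl nl conn ib.
have [lb ne sumQ] := spl.
case: (loop_coloop_cases P Q) => [[e eQ e0]|[_ [e eQ nco]]|[_ co]].
- by move: (nl e eQ); rewrite /r e0.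
- have eP := disjointP dis eQ.
  have lt_n : #|Q :\ e| < n by rewrite -ltnS -(card_delete eQ).
  have splc := splitting_contract rax spl eQ nco nl.
  have spld := splitting_delete rax spl eQ nco nl.
  have rc : contract r e = cycle_rank (e |: P) := cycle_rank_contract P e.
  set c := col e; have lcb : c < b by exact: lb.
  set S := color_class Q col c.
  have eS : e \in S by rewrite inE eQ eqxx.
  have clsE c' : color_class (Q :\ e) col c' =
      if c' == c then S :\ e else color_class Q col c'.
    case: eqP => [->|/eqP c'c]; apply/setP => x; rewrite !inE; first by rewrite andbA.
    case: (eqVneq x e) => //= ->; by rewrite eq_sym (negbTE c'c) andbF.
  have ncoS : r (S :\ e) = r S.
    have sS : [set e] \subset S by rewrite sub1set.
    by have := splitting_class_eq rax spl lcb sS; rewrite [r (Q :\: _)]nco addnC => /addIn.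
  have := delete_or_contract_connected rax (conn c lcb) eS (nl e eQ) ncoS.
  case: (boolP (matroid_connected r (S :\ e))) => [connd _|ncd /= connc] z.
    (* The contraction vanishes in degree i + 1, just above the bound, so exactness of the minor
       would pass to the deletion. *)
    apply: (IH P (Q :\ e) lt_n (delete_disjoint e dis) (delete_sub e PQE) spld).
    + by move=> f /setD1P[_]; exact: nl.
    + by move=> c' lc'; rewrite clsE; case: ifP => _; [exact: connd | exact: conn].
    + by rewrite nco.
    apply: (exact_minor_delete le_total eQ eP z).
    rewrite rc in splc.
    have [h _] := exact_splitting (contract_disjoint e dis) (contract_sub eQ PQE) splc.
    apply: h; rewrite (contract_card dis eQ) addSn -addnS (contract_cycle_rank eQ (nl e eQ)).
    by rewrite -/r addSn ib.
  (* The class of [e] falls apart under deletion, which gives b + 1 summands and kills quantum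
     degree b of the deletion. *)
  have [col' spl'] : exists col', splitting r (Q :\ e) b.+1 col'.
    have cE : S :\ e = color_class (Q :\ e) col c by rewrite clsE eqxx.
    have S0 : S :\ e != set0 by have [_ h _] := spld; rewrite cE; exact: h.
    move: ncd; rewrite /matroid_connected S0 /= negb_forall => /existsP[X].
    rewrite negb_imply negbK => /andP[/and3P[sX X0 XS] /eqP rX].
    by apply: (splitting_refine rax spld lcb (X := X)); rewrite -?cE.
  have [_ d2] := exact_splitting (delete_disjoint e dis) (delete_sub e PQE) spl'.
  have raxc : rank_axioms (contract r e) by apply: contract_rank => //; exact: nl.
  have conncls c' : c' < b ->
      matroid_connected (contract r e) (color_class (Q :\ e) col c').
    move=> lc'; rewrite clsE; case: (c' =P c) => [_|/eqP c'c]; first exact: connc.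
    have := conn c' lc'; rewrite /matroid_connected => /andP[-> /forallP h].
    apply/forallP => X; apply/implyP => hX; have := h X; rewrite hX /=.
    case/and3P: hX => sX _ _.
    by rewrite !(contract_class rax spl lc' c'c eQ) // subsetDl.
  apply: (IH (e |: P) (Q :\ e) lt_n (contract_disjoint e dis) (contract_sub eQ PQE)).
  + by rewrite -rc; exact: splc.
  + move=> f fQ; rewrite -rc.
    have lfb : col f < b by have [h _ _] := splc; exact: h.
    have fcls : f \in color_class (Q :\ e) col (col f) by rewrite inE fQ eqxx.
    case: (eqVneq (col f) c) => [fc|fc]; last first.
      rewrite (contract_class rax spl lfb fc eQ) ?nl //.
        by case/setD1P: fQ.
      by rewrite sub1set inE eqxx andbT; case/setD1P: fQ.
    have fS : f \in S :\ e by move: fcls; rewrite clsE fc eqxx.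
    apply: (matroid_connected_nonloop raxc connc fS).
    (* A connected matroid with a loop is that loop alone; but if only [f] remained, the class would
       be connected in the deletion as well. *)
    apply/eqP => Sf; case/negP: ncd; rewrite Sf /matroid_connected.
    apply/andP; split; first by apply/set0Pn; exists f; rewrite inE.
    apply/forallP => X; apply/implyP => /and3P[sX X0 Xf].
    by case/negP: Xf; move: X0 sX; rewrite subset1 => /negbTE ->; rewrite orbF.
  + by rewrite -rc.
  + by rewrite (contract_card dis eQ) addSn -addnS (contract_cycle_rank eQ (nl e eQ)).
  apply: (exact_minor_contract le_total eQ eP) z; exact: d2.
- have fo := coloops_forest co; have rQ := rank_all_coloops rax co.
  have [_ _] := exact_forest le_total m_gt1 dis PQE fo.
  (* A connected class containing a coloop is a singleton, so each class contributes rank 1. *)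
  suff bQ : b = r Q.
    have iP : i = #|P| by move: ib; rewrite bQ => /addIn.
    by rewrite iP (etrans bQ rQ).
  rewrite -sumQ -{1}[b]card_ord -sum1_card; apply: eq_bigr => c _.
  have /set0Pn[e ec] := ne c (ltn_ord c); have eQ : e \in Q.
    by move: ec; rewrite inE => /andP[].
  rewrite (matroid_connected_coloop rax (conn c (ltn_ord c)) ec) ?nl //.
  exact: (coloop_sub rax (co e eQ) (color_class_sub _ _ _)).
Qed.

End DeletionContraction.

(** * Blocks are the connected components of the cycle matroid *)

Section Blocks.

Variable T : finType.
Implicit Types (F S X Y : {set {set T}}) (A e f g : {set T}) (K : graph T) (u v w x y : T).

Notation r := (@cycle_rank T set0).
Let rax := cycle_rank_axioms (@set0 {set T}).

Lemma rankU1 F u v : r ([set u; v] |: F) = r F + ~~ connect (adj F) u v.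
Proof.
rewrite /cycle_rank !set0U; case: (boolP (connect _ _ _)) => [uv|nuv].
  by rewrite /kappa components_joined // addn0.
have := kappa_anti (sub0set F); rewrite (kappa_merge nuv).
by move: (kappa _) (kappa _); clear; lia.
Qed.

Lemma connect_set0 u v : connect (adj set0) u v = (u == v).
Proof.
apply/idP/eqP => [|->]; last exact: connect0.
have : saturated set0 [set u].
  by apply: adj_saturated => x y; rewrite /adj /= in_set0.
by move=> /[apply] /(_ (set11 u)); rewrite inE => /eqP.
Qed.

(** The edges of [X] and [Y] share at most the vertex [w]. Collapsing all vertices outside [A] to
    [w] fixes the edges of [X] and shrinks those of [Y] to points, so [Y] never helps to connect the
    ends of an edge of [X]. *)
Lemma rank_glue A w X Y : (forall f, f \in X -> #|f| = 2) ->
  (forall f, f \in X -> f \subset w |: A) ->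
  (forall f, f \in Y -> [disjoint f & A]) -> r (X :|: Y) = r X + r Y.
Proof.
move=> X2 XA YA; pose p x := if x \in A then x else w.
have pA x : x \in w |: A -> p x = x.
  by rewrite /p !inE; case: ifP => //; rewrite orbF => _ /eqP.
have retract F x y : F \subset X -> connect (adj (F :|: Y)) x y ->
    connect (adj F) (p x) (p y).
  move=> sF /connectP[q pth ->]; elim: q x pth => [|z q IH] x /=; first by rewrite connect0.
  case/andP=> xz /IH zl; apply: connect_trans zl; move: xz.
  rewrite {1}/adj /= inE => /orP[xzF|/YA dis].
    have /subsetP sx := XA _ (subsetP sF _ xzF).
    by rewrite !pA; [apply: connect1 | apply: sx; rewrite !inE eqxx ?orbT ..].
  by rewrite /p !(disjointFr dis) ?inE ?eqxx ?orbT // connect0.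
apply: (@subset_ind _ (fun F => r (F :|: Y) = r F + r Y) set0).
- exact: sub0set.
- by rewrite set0U (rank0 rax).
move=> e F _ sF eX _ IH; have /eqP/cards2P[u [v [uv eE]]] := X2 e eX.
rewrite eE -setUA !rankU1 IH.
have -> : connect (adj (F :|: Y)) u v = connect (adj F) u v; last by rewrite addnAC.
apply/idP/idP => [/(retract F _ _ sF)|]; last by apply: connect_mono; exact: subsetUl.
have /subsetP sx := XA _ eX.
by rewrite !pA //; apply: sx; rewrite eE !inE eqxx ?orbT.
Qed.

(** Otherwise the edges meeting [A] would split off by [rank_glue]. It is applied with [A] a
    component of the graph, and with [A] a component after deleting the vertex [w]. *)
Lemma connected_meets A w S : matroid_connected r S -> (forall f, f \in S -> #|f| = 2) ->
  (forall f, f \in S -> ~~ [disjoint f & A] -> f \subset w |: A) ->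
  (exists2 f, f \in S & ~~ [disjoint f & A]) ->
  forall f, f \in S -> ~~ [disjoint f & A].
Proof.
move=> /andP[_ /forallP conn] S2 sep [f0 f0S f0A] g gS; apply/negP => gA.
pose X := [set f in S | ~~ [disjoint f & A]].
have sX : X \subset S by apply/subsetP => f; rewrite inE => /andP[].
have := conn X; rewrite sX /= (_ : X != set0) /=; last first.
  by apply/set0Pn; exists f0; rewrite inE f0S.
rewrite (_ : X != S) /=; last first.
  by apply/eqP => /setP/(_ g); rewrite inE gS gA.
rewrite -(@rank_glue A w X (S :\: X)).
- by rewrite setUC setDE setUIl setUC (setUC _ X) setUCr setIT (setUidPr sX) eqxx.
- by move=> f /(subsetP sX); exact: S2.
- by move=> f; rewrite inE => /andP[fS]; exact: sep.
- by move=> f; rewrite !inE; case: (f \in S); rewrite ?andbF //= andbT negbK.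
Qed.

Lemma two_set f a : #|f| = 2 -> a \in f -> exists b, a != b /\ f = [set a; b].
Proof.
move/eqP/cards2P=> [u [v [uv ->]]]; rewrite !inE => /orP[]/eqP ->; first by exists v.
by exists u; rewrite eq_sym uv setUC.
Qed.

Lemma coverP S x : reflect (exists2 f, f \in S & x \in f) (x \in cover S).
Proof. by apply: (iffP bigcupP) => -[f]; exists f. Qed.

Lemma connected_two_connected S : matroid_connected r S ->
  (forall f, f \in S -> #|f| = 2) -> 1 < #|S| -> two_connected (cover S, S).
Proof.
move=> conn S2 S1.
have three : 3 <= #|cover S|.
  have [f [g [fS gS fg]]] := card_gt1P S1.
  rewrite -(S2 f fS); apply: proper_card; apply/properP; split.
    exact: (bigcup_sup f fS).
  have : ~~ (g \subset f).
    apply/negP => gf; case/eqP: fg; apply/esym/eqP.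
    by rewrite eqEcard gf (S2 f fS) (S2 g gS).
  case/subsetPn=> x xg xf; exists x => //; apply/coverP; by exists g.
have [x0 x0S] : exists x, x \in cover S by apply/set0Pn; rewrite -card_gt0; lia.
rewrite /two_connected three /=; apply/andP; split.
  rewrite /connected_graph /=; apply/andP; split; first by apply/set0Pn; exists x0.
  apply/forall_inP => x xS; apply/forall_inP => y yS; apply/negPn/negP => nxy.
  have stay f : f \in S -> ~~ [disjoint f & cls S x] -> f \subset cls S x.
    move=> fS /pred0Pn[a /andP[/= af]]; rewrite inE => xa.
    have [b [_ fE]] := two_set (S2 f fS) af; rewrite fE; apply/subsetP => z.
    rewrite !inE => /orP[]/eqP -> //; apply: connect_trans xa _; apply: connect1.
    by rewrite /adj /= -fE.
  have [g gS yg] := coverP _ _ yS.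
  have : ~~ [disjoint g & cls S x].
    (* No edge leaves a component, so the attaching vertex is a dummy, here [y]. *)
    apply: (@connected_meets _ y S) gS => //.
      by move=> f fS /(stay f fS) h; apply: subset_trans h (subsetUr _ _).
    have [f fS xf] := coverP _ _ xS; exists f => //; apply/pred0Pn; exists x => /=.
    by rewrite xf mem_cls.
  by move/(stay g gS)/subsetP/(_ y yg); rewrite inE (negbTE nxy).
apply/forall_inP => w wS; rewrite /connected_graph /delete_vertex /=.
set Sw := [set f in S | w \notin f].
apply/andP; split.
  by rewrite -card_gt0; have := cardsD1 w (cover S); rewrite wS; lia.
apply/forall_inP => x /setD1P[xw xS]; apply/forall_inP => y /setD1P[yw yS].
apply/negPn/negP => nxy.
have wA : w \notin cls Sw x.
  have sat : saturated Sw [set z | z != w].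
    apply: adj_saturated => a b; rewrite /adj /= !inE => /andP[_].
    by rewrite negb_or ![w == _]eq_sym => /andP[].
  by rewrite inE; apply/negP => /sat; rewrite !inE xw eqxx => /(_ isT).
(* An edge that leaves the component of [x] in the graph without [w] can only go to [w]. *)
have stay f : f \in S -> ~~ [disjoint f & cls Sw x] -> f \subset w |: cls Sw x.
  move=> fS /pred0Pn[a /andP[/= af aA]].
  have [b [_ fE]] := two_set (S2 f fS) af; rewrite fE; apply/subsetP => z.
  rewrite in_set2 in_setU1 => /orP[]/eqP ->; first by rewrite aA orbT.
  case: (boolP (w \in f)) => [|wf].
    rewrite fE !inE => /orP[]/eqP wE; last by rewrite wE eqxx.
    by case/negP: wA; rewrite wE.
  rewrite [b \in cls _ _]inE; apply/orP; right; rewrite inE in aA.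
  by apply: connect_trans aA _; apply: connect1; rewrite /adj /= -fE inE fS.
have [g gS yg] := coverP _ _ yS.
have : ~~ [disjoint g & cls Sw x].
  apply: (@connected_meets _ w S) gS => //.
  have [f fS xf] := coverP _ _ xS; exists f => //; apply/pred0Pn; exists x => /=.
  by rewrite xf mem_cls.
by move/(stay g gS)/subsetP/(_ y yg); rewrite !inE (negbTE yw) (negbTE nxy).
Qed.

Lemma connected_graph_cover K : connected_graph K -> 1 < #|K.1| -> K.1 \subset cover K.2.
Proof.
case/andP=> _ /forall_inP conn K1; apply/subsetP => x xK.
have /set0Pn[y] : K.1 :\ x != set0.
  by rewrite -card_gt0; move: K1; rewrite (cardsD1 x) xK add1n ltnS.
case/setD1P=> yx yK; have /forall_inP/(_ y yK)/connectP[[|z p]] := conn x xK.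
  by move=> _ /= h; rewrite h eqxx in yx.
case/andP=> xz _ _; apply/coverP; exists [set x; z] => //; by rewrite !inE eqxx.
Qed.

(* An edge wa of one side of a separation and an edge wb of the other: a path
   from b to a avoiding w closes wb to a circuit through wa, so wa is spanned by
   the edges of its own side off w, which is impossible as w is isolated there. *)
Lemma two_connected_connected K : well_formed K -> (forall f, f \in K.2 -> #|f| = 2) ->
  two_connected K -> matroid_connected r K.2.
Proof.
move=> /forall_inP wf K2 /and3P[K3 conn /forall_inP del].
have sK := connected_graph_cover conn (ltnW K3).
have [_ /forall_inP con] := andP conn.
apply/andP; split.
  have [x xK] : exists x, x \in K.1 by apply/set0Pn; rewrite -card_gt0; lia.
  by have [f fK _] := coverP _ _ (subsetP sK x xK); apply/set0Pn; exists f.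
apply/forallP => X; apply/implyP => /and3P[sX X0 XK]; apply/negP => /eqP rX.
set Y := K.2 :\: X in rX.
pose col f := if f \in X then 0 else 1.
have cX Z : color_class Z col 0 = Z :&: X.
  by apply/setP => f; rewrite !inE /col; case: (f \in X); rewrite ?andbF.
have spl : splitting r K.2 2 col.
  have c0 : color_class K.2 col 0 = X by rewrite cX; apply/setIidPr.
  have c1 : color_class K.2 col 1 = Y.
    by apply/setP => f; rewrite !inE /col; case: (f \in X); rewrite ?andbF ?andbT.
  split.
  - by move=> f _; rewrite /col; case: ifP.
  - case=> [|[|//]] _; first by rewrite c0.
    by rewrite c1 setD_eq0; apply: contra XK => h; rewrite eqEsubset sX.
  - by rewrite big_ord_recl big_ord1 /= c0 c1.
(* If no vertex met both sides, the vertices covered by [X] would be a union of components, against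
   connectedness. *)
have [w [f [g [fX gY wf_ wg]]]] : exists w f g, [/\ f \in X, g \in Y, w \in f & w \in g].
  apply: contrapT => no.
  have sat : saturated K.2 (cover X).
    apply: adj_saturated => a b ab /coverP[f fX af]; apply/coverP.
    case: (boolP ([set a; b] \in X)) => [h|h]; first exists [set a; b] => //.
      by rewrite !inE eqxx orbT.
    by case: no; exists a, f, [set a; b]; rewrite /Y !inE h eqxx; split.
  have [f fX] := set0Pn _ X0.
  have /set0Pn[g gY] : Y != set0.
    by rewrite setD_eq0; apply: contra XK => h; rewrite eqEsubset sX.
  have fK := subsetP sX f fX; have gK : g \in K.2 by case/setDP: gY.
  have /set0Pn[x xf] : f != set0 by rewrite -card_gt0 (K2 f fK).
  have /set0Pn[y yg] : g != set0 by rewrite -card_gt0 (K2 g gK).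
  have xK := subsetP (wf f fK) x xf; have yK := subsetP (wf g gK) y yg.
  have /forall_inP/(_ y yK)/sat := con x xK.
  case/(_ _)/coverP => [|h hX yh]; first by apply/coverP; exists f.
  by apply: no; exists y, h, g.
have fK := subsetP sX f fX; have gK : g \in K.2 by case/setDP: gY.
have gX : g \notin X by case/setDP: gY.
have [a [wa fE]] := two_set (K2 f fK) wf_; have [b [wb gE]] := two_set (K2 g gK) wg.
have wK := subsetP (wf f fK) w wf_.
have aK : a \in K.1 :\ w.
  by rewrite !inE eq_sym wa (subsetP (wf f fK)) // fE !inE eqxx orbT.
have bK : b \in K.1 :\ w.
  by rewrite !inE eq_sym wb (subsetP (wf g gK)) // gE !inE eqxx orbT.
have /andP[_ /forall_inP/(_ b bK)/forall_inP/(_ a aK)] := del w wK.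
rewrite /delete_vertex /=; set Kw := [set h in K.2 | w \notin h] => ba.
pose F := g |: Kw.
have sF : F \subset K.2.
  by rewrite subUset sub1set gK; apply/subsetP => h; rewrite inE => /andP[].
have wFa : connect (adj F) w a.
  apply: (@connect_trans _ _ b); first by apply: connect1; rewrite /adj /= -gE setU11.
  by apply: connect_mono ba; exact: subsetUr.
have sfF : f |: F \subset K.2 by rewrite subUset sub1set fK.
(* Adding [f] to [F] does not raise the rank; as ranks split along [X] and [f] belongs to [X],
   adding it to [F :&: X] does not raise the rank either. *)
have wa' : connect (adj (F :&: X)) w a.
  have := splitting_class_compl rax spl (isT : 0 < 2) sF.
  have := splitting_class_compl rax spl (isT : 0 < 2) sfF.
  have rfF : r (f |: F) = r F by rewrite fE rankU1 wFa addn0.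
  have rfX : r (f |: (F :&: X)) = r (F :&: X) + ~~ connect (adj (F :&: X)) w a.
    by rewrite fE rankU1.
  rewrite !cX rfF.
  have -> : (f |: F) :&: X = f |: (F :&: X).
    by rewrite setIUl (setIidPl _) // sub1set.
  have DF (Z : {set {set T}}) : (f |: Z) :\: (f |: (Z :&: X)) = Z :\: (Z :&: X).
    apply/setP => h; rewrite !inE; case: (h =P f) => [->|//] /=.
    by rewrite fX andbT andNb.
  rewrite DF.
  rewrite rfX; case: (connect _ _ _) => //=.
  by move: (r _) (r _) (r _); clear; lia.
have sat : saturated (F :&: X) [set w].
  apply: adj_saturated => x y; rewrite /adj /= !inE => + /eqP xw; rewrite {}xw.
  case/andP=> /orP[/eqP h|/andP[_]]; first by rewrite h (negbTE gX).
  by rewrite eqxx.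
by have := sat _ _ wa' (set11 w); rewrite inE eq_sym (negbTE wa).
Qed.

Section Count.

Variables (E : {set {set T}}) (b : nat) (col : {set T} -> nat).
Hypothesis E2 : simple_graph E.
Hypothesis spl : splitting r E b col.
Hypothesis conn : forall c, c < b -> matroid_connected r (color_class E col c).

Let S c := color_class E col c.
Let sS c : S c \subset E. Proof. exact: color_class_sub. Qed.
Let S2 c f : f \in S c -> #|f| = 2. Proof. by move/(subsetP (sS c)); exact: E2. Qed.

Lemma simple_graph_rank1 f : f \in E -> r [set f] = 1.
Proof.
move=> /E2 /eqP/cards2P[u [v [uv ->]]].
by rewrite -[[set [set u; v]]]setU0 rankU1 (rank0 rax) connect_set0 uv.
Qed.

Lemma bridge_coloop f : bridge E f = (f \in E) && (r (E :\ f) < r E).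
Proof.
rewrite /bridge -/(kappa E) -/(kappa (E :\ f)) /cycle_rank !set0U; congr andb.
have := kappa_anti (sub0set E); have := kappa_anti (sub0set (E :\ f)).
by move: (kappa E) (kappa (E :\ f)) (kappa set0); clear; lia.
Qed.

(** A class with one edge is a coloop, hence a bridge. A larger one is 2-connected, and maximal
    because a 2-connected graph containing it has a connected matroid and so stays within one
    class. *)
Let class_block c : c < b -> (cover (S c), S c) \in blocks E.
Proof.
move=> lcb; have [lb ne _] := spl; have /set0Pn[f fS] := ne c lcb.
have fE := subsetP (sS c) f fS; rewrite inE.
case: (leqP #|S c| 1) => S1.
  have Sf : S c = [set f].
    by apply/esym/eqP; rewrite eqEcard sub1set fS cards1.
  apply/orP; right; apply/imsetP; exists f; last by rewrite Sf /cover big_set1.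
  rewrite inE bridge_coloop fE /=.
  have sf : [set f] \subset S c by rewrite sub1set.
  have := splitting_class_eq rax spl lcb sf; rewrite -/(S c) Sf setDv (rank0 rax) add0n.
  by rewrite simple_graph_rank1 // addn1 => <-.
apply/orP; left; rewrite inE; apply/andP; split.
  apply/and3P; split.
  - by apply/forall_inP => g gS; exact: (bigcup_sup g gS).
  - by rewrite /subgraph /= subsetT sS.
  - by apply: connected_two_connected => //; [exact: conn | exact: S2].
apply/forallP => L; apply/implyP => /andP[/and3P[wf /andP[_ /= LE] tc] /andP[/= h1 h2]].
have L2 g : g \in L.2 -> #|g| = 2 by move/(subsetP LE); exact: E2.
have Lc := two_connected_connected wf L2 tc.
have [c' lc' Lc'] := matroid_connected_class rax spl Lc LE.
have cc' : c' = c.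
  move: fS (subsetP Lc' _ (subsetP h2 f fS)); rewrite !inE => /andP[_ /eqP ->].
  by case/andP=> _ /eqP.
have L2E : L.2 = S c by apply/eqP; rewrite eqEsubset h2 andbT -cc'.
case/and3P: tc => L3 Lcon _.
have := connected_graph_cover Lcon (ltnW L3); rewrite L2E => h3.
case: L h1 L2E h3 {h2 wf LE L2 Lc Lc' L3 Lcon} => L1 L2' /= h1 -> h3.
by rewrite xpair_eqE eqxx andbT eqEsubset h1 h3.
Qed.

(** Conversely, the edges of a maximal 2-connected subgraph lie in one class; having three vertices,
    the subgraph forces that class to have several edges, so the class is itself 2-connected and
    equals it. *)
Lemma card_blocks : #|blocks E| = b.
Proof.
have [lb ne _] := spl.
suff -> : blocks E = [set (cover (S c), S c) | c : 'I_b].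
  rewrite card_imset ?card_ord // => c c' [_ h]; apply/val_inj.
  have /set0Pn[f fS] := ne c (ltn_ord c); move: (fS); rewrite -/(S c) h.
  move: fS; rewrite !inE => /andP[_ /eqP e1] /andP[_ /eqP e2].
  exact: etrans (esym e1) e2.
apply/eqP; rewrite eqEsubset; apply/andP; split; last first.
  by apply/subsetP => _ /imsetP[c _ ->]; exact: class_block.
apply/subsetP => K; rewrite inE => /orP[|/imsetP[f]]; last first.
  rewrite inE bridge_coloop => /andP[fE co] ->.
  have lc := lb f fE; apply/imsetP; exists (Ordinal lc) => //=.
  have fS : f \in S (col f) by rewrite inE fE eqxx.
  have -> : S (col f) = [set f].
    apply: (matroid_connected_coloop rax (conn lc) fS).
    exact: (coloop_sub rax co (sS _)).
  by rewrite /cover big_set1.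
rewrite inE => /andP[/and3P[wf /andP[_ /= KE] tc] /forallP max].
have K2 g : g \in K.2 -> #|g| = 2 by move/(subsetP KE); exact: E2.
have Kc := two_connected_connected wf K2 tc.
have [c lc sK] := matroid_connected_class rax spl Kc KE.
apply/imsetP; exists (Ordinal lc) => //=; rewrite -/(S c) in sK *.
have /and3P[K3 Kcon _] := tc.
have cK := connected_graph_cover Kcon (ltnW K3).
have S1 : 1 < #|S c|.
  rewrite ltnNge; apply/negP => S1.
  have /andP[/set0Pn[f fK] _] := Kc; have fS := subsetP sK f fK.
  have Sf : S c = [set f] by apply/esym/eqP; rewrite eqEcard sub1set fS cards1.
  have : K.1 \subset f.
    apply: subset_trans cK _; apply/subsetP => x /coverP[g gK xg].
    by move: (subsetP sK g gK); rewrite Sf inE => /eqP <-.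
  by move/subset_leq_card; rewrite (K2 f fK) leqNgt K3.
have := max (cover (S c), S c); rewrite [X in X ==> _](_ : _ = true) /=.
  by move/eqP.
rewrite /two_connected_subgraph /subgraph /= subsetT sS sK !andbT.
rewrite (connected_two_connected (conn lc) (@S2 c) S1) !andbT; apply/andP; split.
  by apply/forall_inP => g gS; exact: (bigcup_sup g gS).
apply: subset_trans cK _; apply/subsetP => x /coverP[g gK xg]; apply/coverP.
by exists g => //; exact: (subsetP sK).
Qed.

End Count.

End Blocks.

(** * The extreme degrees and the span *)

Lemma kappa_set0 (T : finType) : kappa (@set0 {set T}) = #|T|.
Proof.
rewrite /kappa (_ : components set0 = [set cls set0 x | x : T]).
  by rewrite card_imset // => x y /eqP; rewrite cls_eqE connect_set0 => /eqP.
apply/setP => C; apply/componentsP/imsetP => [[x ->]|[x _ ->]]; by exists x.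
Qed.

Lemma kappa_connected (T : finType) (E : {set {set T}}) :
  connected_graph ([set: T], E) -> kappa E = 1.
Proof.
case/andP=> /set0Pn[/= x _] /forall_inP conn.
have cE y : cls E y = [set: T].
  apply/setP => z; rewrite !inE.
  by have /forall_inP/(_ z (in_setT z)) := conn y (in_setT y).
rewrite /kappa (_ : components E = [set [set: T]]) ?cards1 //.
apply/setP => C; rewrite inE; apply/componentsP/eqP => [[y ->]|->] //.
by exists x; rewrite cE.
Qed.

(* All vertices carrying x^(m-1), every merge vanishes in Z[x]/(x^m). *)
Lemma nonzero_degree0 (m : nat) (T : finType) (E : {set {set T}}) (le : rel {set T}) :
  1 < m -> simple_graph E -> nonzero_degree m E le 0.
Proof.
move=> m1 E2; have [|||s [sE ls]] := @state_ex T m E set0 (fun=> m.-1) => //.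
- exact: sub0set.
- by move=> _; lia.
apply/nonzero_degreeP; exists (qdeg s) => z.
have sm : s \in minor m E set0 E (qdeg s) by rewrite inE sE !sub0set eqxx.
have [||b [degb db]] := z (fun t => if t == s then 1%R else 0%R).
- by move=> t _; case: (t =P s) => // ->; rewrite /hdeg sE cards0 eqxx.
- move=> t _; rewrite /diff big1 // => s' _; case: eqP => [->|_]; last by rewrite mul0r.
  rewrite mul1r; apply/eqP/negPn/negP => /dcoef_neq0[/sleP[_ lt] [e [_ tE]]].
  have : e \in E by apply: (subsetP (sedges_sub t)); rewrite tE setU11.
  move/E2/eqP/cards2P => [u [v [uv eE]]].
  (* The ends of an edge are distinct, so their labels merge to the exponent 2(m-1), which is at
     least m. *)
  have := lt u; rewrite tE eE weight_merge sE ?connect_set0 // eqxx /= !ls.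
  by have := labv_lt t u; lia.
have := db s sm; rewrite eqxx /diff big1 // => t tm.
by have [->|/(degb t tm)] := eqVneq (b t) 0%R; rewrite ?mul0r.
Qed.

Theorem theorem4p5 (m : nat) (hm : 2 <= m) (T : finType) (E : {set {set T}})
    (hE : simple_graph E) (hconn : connected_graph ([set: T], E))
    (le : rel {set T}) (hle : total_order_on E le) :
  is_hspan m E le (#|T| - #|blocks E|).
Proof.
have rax := cycle_rank_axioms (@set0 {set T}).
have [b [col [spl conn]]] := exists_connected_splitting E rax.
have nl f : f \in E -> cycle_rank set0 [set f] = 1 by exact: simple_graph_rank1.
have rE : (cycle_rank set0 E).+1 = #|T|.
  have /andP[/set0Pn[x _] _] := hconn.
  rewrite /cycle_rank set0U kappa_set0 kappa_connected // subn1 prednK //.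
  by apply/card_gt0P; exists x.
have bE : b <= cycle_rank set0 E by exact: splitting_le_rank spl nl.
have dis : [disjoint @set0 {set T} & E].
  by apply/pred0P => f; rewrite /= inE.
have sE : set0 :|: E \subset E by rewrite set0U.
rewrite (card_blocks hE spl conn) -rE.
(* With r = v - 1 the span is (r - b) - 0 + 1 = v - b; [bE] keeps the subtractions exact. *)
exists 0, (cycle_rank set0 E - b); split => //.
- exact: nonzero_degree0.
- apply/nonzero_degreeP; exists b.
  apply: (nonexact_splitting hle hm dis sE spl nl conn).
  by rewrite subnK // cards0.
- move=> i /nonzero_degreeP[j nZ]; rewrite leqNgt; apply/negP => lt.
  have [h _] := exact_splitting hle hm dis sE spl.
  by apply: nZ; apply: h; rewrite cards0 add0n addnC -ltn_subLR.
- by rewrite subn0 addn1 subSn.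
Qed.
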